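(* Let $k$ be an algebraically closed field and let $P\subset\mathbb{R}^n$ be a lattice polytope with $\dim P=n$ and $\mathrm{gp}(S_P)=\mathbb{Z}^{n+1}$. Suppose the codimension $1$ retraction $h:k[P]\to k[P]$ has a base $F$ not intersecting the interior of $P$. Then $F$ is a facet of $P$ and $$h^{\epsilon}=\iota\circ\pi_F$$ for some $\epsilon\in\mathbb{A}(F)$ and some graded $k$-algebra embedding $\iota:k[F]\to k[P]$.
   Context: A lattice polytope $P\subset\mathbb{R}^n$ is the convex hull of a finite set of points of $\mathbb{Z}^n$ (the empty polytope, of dimension $-1$, is allowed with $k[\emptyset]=k$). Put $L_P=P\cap\mathbb{Z}^n$, and let $S_P\subset\mathbb{Z}^{n+1}$ be the sub-semigroup (with $0$) generated by $\{(x,1)\mid x\in L_P\}$; $\mathrm{gp}(S_P)$ is its group of differences. The algebra $k[P]:=k[S_P]$ is the semigroup algebra of $S_P$, graded by the last coordinate; $x\in L_P$ is identified with the degree $1$ element $(x,1)$. If $Q\subset P$ is a lattice subpolytope, $k[Q]$ is regarded as the subalgebra of $k[P]$ generated by $L_Q\subset L_P$, and $S_Q\subset S_P$. A retraction $h:k[P]\to k[P]$ is an idempotent homogeneous $k$-algebra endomorphism; $\mathrm{codim}(h)=\dim k[P]-\dim \mathrm{Im}(h)$ (Krull dimensions). Base: with $A=\mathrm{Im}(h)$, a base of $h$ is a $(\dim A-1)$-dimensional cross section $Q=P\cap H$ of $P$ by an affine subspace $H$ such that $Q$ is a lattice polytope and $h|_{k[Q]}:k[Q]\to A$ is an isomorphism.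 For a face $F$ of $P$, $\pi_F:k[P]\to k[F]$ is the homomorphism which is the identity on $L_F$ and sends $L_P\setminus L_F$ to $0$. For a graded $k$-algebra automorphism $\alpha$ of $k[P]$, $h^\alpha:=\alpha\circ h\circ\alpha^{-1}$. A nonzero $v\in\mathbb{Z}^n$ is a column vector of $P$ with base facet $F$ if $F$ is a facet of $P$ and $x+v\in P$ for every lattice point $x\in P\setminus F$. For such $v$ (identified with $(v,0)\in\mathrm{gp}(S_P)$) and $x\in S_P$, let $\mathrm{ht}_v(x)$ be the largest integer $m\ge 0$ with $x+mv\in S_P$ (for $x\in S_F$ put $\mathrm{ht}_v(x)=0$). For $\lambda\in k$ the assignment $x\mapsto(1+\lambda v)^{\mathrm{ht}_v(x)}x$, $x\in S_P$ (computed in $k[\mathrm{gp}(S_P)]$, with the semigroup written multiplicatively), defines a graded $k$-algebra automorphism $e_v^\lambda$ of $k[P]$. If $v_1,\dots,v_s$ are all the pairwise different column vectors of $P$ with base facet $F$, then $\mathbb{A}(F)$ is the (commutative) group of all automorphisms $e_{v_1}^{\lambda_1}\circ\cdots\circ e_{v_s}^{\lambda_s}$, $\lambda_i\in k$ (it consists only of the identity if there is no such column vector). *)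

(* Defs.v *)
From HB Require Import structures.
From mathcomp Require Import all_boot all_order all_algebra finmap.
From mathcomp Require Import all_classical all_reals topology normedtype.
(* The notations of [monalg] clash with those of MathComp-Analysis. *)
From mathcomp Require Import -(notations) monalg.

Set Implicit Arguments.
Unset Strict Implicit.
Unset Printing Implicit Defensive.

Import Order.TTheory GRing.Theory Num.Theory.
Import numFieldNormedType.Exports.

Local Open Scope classical_set_scope.
Local Open Scope ring_scope.

(* [malg G k] carries a product only for a monoid without nontrivial units, so
   the convolution product of the group algebra k[G] is put on an alias. *)
Definition grpalg (k : comNzRingType) (G : zmodType) : Type := malg G k.

Section GroupAlgebra.
Context (k : comNzRingType) (G : zmodType).

HB.instance Definition _ := GRing.Lmodule.copy (grpalg k G) (malg G k).

Implicit Types (f g h : grpalg k G) (x y : G).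

Definition mon x : grpalg k G := mkmalgU x 1.

Definition gmul f g : grpalg k G :=
  \sum_(x <- msupp f) \sum_(y <- msupp g)
    mkmalgU (x + y) (mcoeff x f * mcoeff y g).

Lemma gmulw (d1 d2 : {fset G}) f g :
  (msupp f `<=` d1)%fset -> (msupp g `<=` d2)%fset ->
  gmul f g = \sum_(x <- d1) \sum_(y <- d2)
    mkmalgU (x + y) (mcoeff x f * mcoeff y g).
Proof.
move=> le1 le2; rewrite /gmul (big_fset_incl _ le1) /=.
  apply: eq_bigr => x _; apply: big_fset_incl => // y _ /mcoeff_outdom ->.
  by rewrite mulr0 monalgU0.
move=> x _ /mcoeff_outdom fx; rewrite big1 // => y _.
by rewrite fx mul0r monalgU0.
Qed.

Lemma gmulC : commutative gmul.
Proof.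
move=> f g; rewrite /gmul exchange_big /=.
by apply: eq_bigr => y _; apply: eq_bigr => x _; rewrite addrC mulrC.
Qed.

Lemma gmulUU a b x y :
  gmul (mkmalgU x a) (mkmalgU y b) = mkmalgU (x + y) (a * b).
Proof.
rewrite (gmulw (d1 := [fset x]%fset) (d2 := [fset y]%fset)) ?msuppU_le //.
by rewrite !big_seq_fset1 !mcoeffUU.
Qed.

Lemma gmulDl : left_distributive gmul +%R.
Proof.
move=> f1 f2 g; set d := (msupp f1 `|` msupp f2)%fset.
rewrite (gmulw (d1 := d) (d2 := msupp g)) ?msuppD_le //.
rewrite (gmulw (f := f1) (d1 := d) (d2 := msupp g)) ?fsubsetUl //.
rewrite (gmulw (f := f2) (d1 := d) (d2 := msupp g)) ?fsubsetUr //.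
rewrite -big_split; apply: eq_bigr => x _ /=.
rewrite -big_split; apply: eq_bigr => y _ /=.
by rewrite mcoeffD mulrDl monalgUD.
Qed.

Lemma gmulDr : right_distributive gmul +%R.
Proof. by move=> f g1 g2; rewrite gmulC gmulDl !(gmulC f). Qed.

Lemma gmul0 : right_zero 0 gmul.
Proof.
by move=> f; apply: (addrI (gmul f 0)); rewrite -gmulDr !addr0.
Qed.

Lemma gmul0g : left_zero 0 gmul.
Proof. by move=> f; rewrite gmulC gmul0. Qed.

Lemma gmul_suml (I : Type) (r : seq I) (F : I -> grpalg k G) g :
  gmul (\sum_(i <- r) F i) g = \sum_(i <- r) gmul (F i) g.
Proof. exact: (big_morph (gmul^~ g) (fun a b => gmulDl a b g) (gmul0g g)). Qed.

Lemma gmul_sumr (I : Type) (r : seq I) (F : I -> grpalg k G) g :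
  gmul g (\sum_(i <- r) F i) = \sum_(i <- r) gmul g (F i).
Proof. exact: (big_morph (gmul g) (gmulDr g) (gmul0 g)). Qed.

Lemma gmulEl f g :
  gmul f g = \sum_(x <- msupp f) gmul (mkmalgU x (mcoeff x f)) g.
Proof. by rewrite -gmul_suml -monalgE. Qed.

Lemma gmulEr f g :
  gmul f g = \sum_(x <- msupp g) gmul f (mkmalgU x (mcoeff x g)).
Proof. by rewrite -gmul_sumr -monalgE. Qed.

Lemma gmulA : associative gmul.
Proof.
move=> f g h.
rewrite (gmulEl f (gmul g h)) (gmulEl f g) (gmul_suml (msupp f)).
apply: eq_bigr => x _.
rewrite (gmulEl g h) (gmul_sumr (msupp g)) (gmulEr (mkmalgU x _) g).
rewrite (gmul_suml (msupp g)); apply: eq_bigr => y _.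
rewrite (gmulEr (mkmalgU y _) h) (gmul_sumr (msupp h)).
rewrite (gmulEr (gmul _ _) h); apply: eq_bigr => z _.
by rewrite !gmulUU addrA mulrA.
Qed.

Lemma gmul1g : left_id (mon 0) gmul.
Proof.
move=> f; rewrite [f in LHS]monalgE gmul_sumr [RHS]monalgE.
by apply: eq_bigr => x _; rewrite gmulUU add0r mul1r.
Qed.

Lemma gone_neq0 : mon 0 != 0.
Proof.
by apply/eqP => /malgP /(_ 0) /eqP; rewrite mcoeffUU mcoeff0 oner_eq0.
Qed.

HB.instance Definition _ :=
  GRing.Zmodule_isComNzRing.Build (grpalg k G) gmulA gmulC gmul1g gmulDl
    gone_neq0.

Lemma gmulZl (a : k) f g : a *: (f * g) = (a *: f) * g.
Proof.
have scaleE (c : k) (h : grpalg k G) : c *: h = gmul (mkmalgU 0 c) h.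
  rewrite [h in RHS]monalgE gmul_sumr.
  rewrite -[LHS]/(fgscale c h) /fgscale.
  by apply: eq_bigr => x _; rewrite gmulUU add0r.
by rewrite !scaleE; apply: gmulA.
Qed.

HB.instance Definition _ := GRing.Lmodule_isLalgebra.Build k (grpalg k G) gmulZl.
HB.instance Definition _ := GRing.Lalgebra_isComAlgebra.Build k (grpalg k G).

Lemma msuppM_le f g z : z \in msupp (f * g) ->
  exists x y, [/\ x \in msupp f, y \in msupp g & z = x + y].
Proof.
rewrite -mcoeff_neq0 => nz; apply: contrapT => H; case/negP: nz; apply/eqP.
rewrite -[f * g]/(gmul f g) /gmul raddf_sum big_seq big1 // => x xf.
rewrite raddf_sum big_seq big1 // => y yg /=; rewrite mcoeffU.
by have [E|//] := eqVneq; case: H; exists x, y.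
Qed.

End GroupAlgebra.

Section Polytopes.
Context (R : realType) (n : nat).
Implicit Types (P Q F A H : set 'rV[R]_n).

Definition conv_hull (m : nat) (p : 'I_m -> 'rV[R]_n) : set 'rV[R]_n :=
  [set x | exists w : 'I_m -> R,
    [/\ forall i, 0 <= w i, \sum_i w i = 1 & x = \sum_i w i *: p i]].

Definition of_int (x : 'rV[int]_n) : 'rV[R]_n := map_mx intr x.

(* The empty family yields the empty polytope. *)
Definition lattice_polytope P : Prop :=
  exists (m : nat) (p : 'I_m -> 'rV[int]_n), P = conv_hull (of_int \o p).

Definition aff_indep (m : nat) (p : 'I_m -> 'rV[R]_n) : Prop :=
  forall c : 'I_m -> R,
    \sum_i c i = 0 -> \sum_i c i *: p i = 0 -> forall i, c i = 0.

(* One less than the largest size of an affinely independent family of points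
   of A; such a family has at most n + 1 members, and affdim set0 = -1. *)
Definition affdim A : int :=
  (\max_(m < n.+2 | `[< exists p : 'I_m -> 'rV[R]_n,
      (forall i, A (p i)) /\ aff_indep p >]) m)%:Z - 1.

(* The empty set is an affine subspace. *)
Definition affine_subspace H : Prop :=
  forall (t : R) x y, H x -> H y -> H ((1 - t) *: x + t *: y).

(* The linear form l may be zero, so P and the empty set are faces of P. *)
Definition face P F : Prop :=
  exists (l : 'cV[R]_n) (b : R),
    (forall x, P x -> (x *m l) 0 0 <= b) /\
    F = P `&` [set x | (x *m l) 0 0 = b].

Definition facet P F : Prop := face P F /\ affdim F = affdim P - 1.

Definition lattice_points P : set 'rV[int]_n := [set x | P (of_int x)].

(* Z^(n+1) is Z^n * Z; the second component is the last coordinate. *)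
Definition amb : zmodType := ('rV[int]_n * int)%type.

Definition deg1 (x : 'rV[int]_n) : amb := (x, 1).
Definition deg0 (v : 'rV[int]_n) : amb := (v, 0).

Definition semigp P : set amb :=
  [set z | exists2 s : seq 'rV[int]_n,
    {in s, forall x, lattice_points P x} & z = \sum_(x <- s) deg1 x].

Definition gp P : set amb :=
  [set z | exists a b, [/\ semigp P a, semigp P b & z = a - b]].

Lemma semigp0 P : semigp P 0.
Proof. by exists [::]; rewrite ?big_nil. Qed.

Lemma semigpD P a b : semigp P a -> semigp P b -> semigp P (a + b).
Proof.
move=> [s sP ->] [t tP ->]; exists (s ++ t); last by rewrite big_cat.
by move=> x; rewrite mem_cat => /orP[/sP|/tP].
Qed.

Lemma semigp_deg1 P x : lattice_points P x -> semigp P (deg1 x).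
Proof.
move=> Px; exists [:: x]; last by rewrite big_seq1.
by move=> y; rewrite inE => /eqP ->.
Qed.

Definition column_vector P F (v : 'rV[int]_n) : Prop :=
  [/\ v != 0, facet P F
    & forall x, lattice_points P x -> ~ F (of_int x) -> P (of_int (x + v))].

(* xget returns the maximum, which exists when v is nonzero and x is in S_P. *)
Definition ht P F (v : 'rV[int]_n) (x : amb) : nat :=
  if `[< semigp F x >] then 0%N
  else xget 0%N [set m : nat | semigp P (x + deg0 v *+ m) /\
         forall m' : nat, semigp P (x + deg0 v *+ m') -> (m' <= m)%N].

End Polytopes.

Section PolytopalAlgebra.
Context (k : fieldType) (R : realType) (n : nat).
Implicit Types P Q F : set 'rV[R]_n.

Definition supported P : {pred grpalg k (amb n)} :=
  fun f => `[< forall z, z \in msupp f -> semigp P z >].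

Lemma supported_subalg P : GRing.subalg_closed (supported P).
Proof.
split=> [|a f g /asboolP fP /asboolP gP|f g /asboolP fP /asboolP gP].
- apply/asboolP => z /(fsubsetP msuppU_le); rewrite inE => /eqP ->.
  exact: semigp0.
- apply/asboolP => z /(fsubsetP (msuppD_le _ _)); rewrite inE.
  by case/orP=> [/(fsubsetP (msuppZ_le _ _))/fP|/gP].
- apply/asboolP => z /msuppM_le[x [y [/fP Px /gP Py ->]]].
  exact: semigpD.
Qed.

HB.instance Definition _ P :=
  GRing.isSubalgClosed.Build k (grpalg k (amb n)) (supported P)
    (GRing.subalg_closed_semi (supported_subalg P)).

Record polyalg P : predArgType := PolyAlg {
  polyalg_val :> grpalg k (amb n);
  polyalg_valP : polyalg_val \in supported P
}.

HB.instance Definition _ P := [isSub for @polyalg_val P].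
HB.instance Definition _ P := [Choice of polyalg P by <:].
HB.instance Definition _ P :=
  [SubChoice_isSubComNzRing of polyalg P by <:].
HB.instance Definition _ P := [SubZmodule_isSubLmodule of polyalg P by <:].
HB.instance Definition _ P :=
  [SubNzRing_SubLmodule_isSubLalgebra of polyalg P by <:].
HB.instance Definition _ P := [SubLalgebra_isSubAlgebra of polyalg P by <:].

Lemma mon_supported P z : semigp P z -> mon k z \in supported P.
Proof.
by move=> Pz; apply/asboolP => y /(fsubsetP msuppU_le); rewrite inE => /eqP ->.
Qed.

Definition pmon P z (Pz : semigp P z) : polyalg P := PolyAlg (mon_supported Pz).

Definition pvar P x (Px : lattice_points P x) : polyalg P :=
  pmon (semigp_deg1 Px).

(* k[Q], as a subset of k[P], when Q is contained in P. *)
Definition subpolyalg P Q : set (polyalg P) :=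
  [set f | polyalg_val f \in supported Q].

Definition homog P (d : int) (f : polyalg P) : Prop :=
  forall z, z \in msupp (polyalg_val f) -> z.2 = d.

Definition graded P Q (f : polyalg P -> polyalg Q) : Prop :=
  forall d x, homog d x -> homog d (f x).

Definition retraction P (h : {lrmorphism polyalg P -> polyalg P}) : Prop :=
  idempotent_fun h /\ graded h.

(* Determines pi = pi_F, since k[P] is generated by L_P. *)
Definition face_proj P F (pi : {lrmorphism polyalg P -> polyalg F}) : Prop :=
  forall x (Px : lattice_points P x),
    (forall Fx : lattice_points F x, pi (pvar Px) = pvar Fx) /\
    (~ lattice_points F x -> pi (pvar Px) = 0).

(* Determines e = e_v^lambda, since k[P] is spanned by S_P; the right-hand side
   lives in k[Z^(n+1)]. *)
Definition elementary P F (v : 'rV[int]_n) (lambda : k)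
    (e : {lrmorphism polyalg P -> polyalg P}) : Prop :=
  forall z (Pz : semigp P z),
    polyalg_val (e (pmon Pz)) =
      (1 + lambda *: mon k (deg0 v)) ^+ ht P F v z * mon k z.

(* The group A(F): the composites of one e_v^lambda for each column vector v
   with base facet F. *)
Definition colgroup P F : set (polyalg P -> polyalg P) :=
  [set eps | exists (s : nat) (v : 'I_s -> 'rV[int]_n) (lambda : 'I_s -> k)
       (e : 'I_s -> {lrmorphism polyalg P -> polyalg P}),
    [/\ injective v, range v = column_vector P F,
        forall i, elementary F (v i) (lambda i) (e i)
      & eps = \big[comp/id]_(i < s) (e i : polyalg P -> polyalg P)]].

(* g = alpha \o h \o alpha^-1. *)
Definition conjugate P (alpha h g : polyalg P -> polyalg P) : Prop :=
  exists alpha', [/\ cancel alpha alpha', cancel alpha' alpha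
                   & g =1 alpha \o h \o alpha'].

End PolytopalAlgebra.

Section Krull.
Context (A : comNzRingType).
Implicit Types B p : set A.

(* p is a prime ideal of the subring B of A. *)
Definition prime_ideal B p : Prop :=
  [/\ p `<=` B /\ p 0, ~ p 1,
      forall x y, p x -> p y -> p (x - y),
      forall b x, B b -> p x -> p (b * x)
    & forall x y, B x -> B y -> p (x * y) -> p x \/ p y].

Definition prime_chain B (d : nat) : Prop :=
  exists p : nat -> set A,
    (forall i, (i <= d)%N -> prime_ideal B (p i)) /\
    (forall i, (i < d)%N -> p i `<` p i.+1).

Definition krull_dim B (d : nat) : Prop :=
  prime_chain B d /\ forall e, prime_chain B e -> (e <= d)%N.

End Krull.

Section RetractionBase.
Context (k : fieldType) (R : realType) (n : nat).
Implicit Types (P Q : set 'rV[R]_n).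

Definition codim P (h : polyalg k P -> polyalg k P) (c : int) : Prop :=
  exists a b : nat, [/\ krull_dim [set: polyalg k P] a,
    krull_dim (range h) b & c = a%:Z - b%:Z].

Definition base P (h : {lrmorphism polyalg k P -> polyalg k P}) Q : Prop :=
  exists d : nat,
    [/\ krull_dim (range h) d,
        affdim Q = d%:Z - 1,
        exists2 H, affine_subspace H & Q = P `&` H,
        lattice_polytope Q
      & set_bij (subpolyalg Q) (range h) h].

End RetractionBase.

(* Main.v *)
Require Import Defs.
From HB Require Import structures.
From mathcomp Require Import all_boot all_order all_algebra finmap.
From mathcomp Require Import all_classical all_reals topology normedtype.
From mathcomp Require Import -(notations) monalg.
From mathcomp Require Import zify.

Set Implicit Arguments.
Unset Strict Implicit.
Unset Printing Implicit Defensive.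

Import Order.TTheory GRing.Theory Num.Theory.
Import numFieldNormedType.Exports.

Local Open Scope classical_set_scope.
Local Open Scope ring_scope.

(** Why the theorem holds.

    The base F is a facet.  The algebra k[P] has a chain of n + 2 primes, so
    its Krull dimension is at least n + 1, and codimension 1 forces the
    dimension of F to be at least n - 1 ([prime_chain_polyalg]).  On the other
    hand F contains no full simplex, whose interior would lie in the interior
    of P ([base_no_simplex]).  So F spans a hyperplane, and P lies on one side
    of it: a segment from an interior point of P to a point on the other side
    would meet F inside P ([base_is_face]).  The lattice distance from this
    hyperplane, the height, is an additive map from Z^(n+1) onto Z that is
    nonnegative on S_P and vanishes exactly on S_F ([lattice_height_exists]).

    Let g be h followed by the inverse of its restriction to k[F].  It is a
    graded retraction of k[P] onto k[F], and it has the form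
<<
      g(z) = sigma^(height of z) * z      for every monomial z of k[P],
>>
    for one element sigma of the group algebra ([retr_formula]).  If g kills
    some monomial, it kills all those of positive height, because any two of
    them have multiples that agree modulo gp(S_F); then sigma = 0.
    Otherwise the leading monomial of g(z), for a fixed total order on
    Z^(n+1), is additive in z and equal to z on S_F, hence it is z plus height
    of z times a fixed vector s ([leading_shift]).  Convexity of P makes s a
    column vector, so there is a monomial y of height 1, and sigma = g(y) / y.

    Every monomial of sigma is a column vector ([admissible_columns]).  The
    leading one is, by the argument above; composing g with its elementary
    automorphism subtracts that term from sigma, and one goes on with fewer
    terms.  So no convex geometry of Newton polytopes is involved.

    For tau a combination of column vectors, z |-> (1 + tau)^(height of z) * z
    is an automorphism E_tau of k[P].  Column vectors have height -1, which
    gives E_tau E_tau' = E_(tau + tau') ([colautD]), so that E_tau is composed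
    of elementary automorphisms and lies in A(F) ([colaut_colgroup]).  Expanding
    (1 + sigma)^m * z, only the last term has height 0, so that the face
    projection sends E_sigma(z) to sigma^m * z = g(z) ([facet_proj_colmon]).
    Hence h = h o pi_F o E_sigma, and conjugation by E_sigma gives the claim
    with iota = E_sigma o h restricted to k[F]. *)

(** * Group algebras *)

Section Monomials.
Context (k : comNzRingType) (G : zmodType).
Implicit Types (f g : grpalg k G) (x y z : G).

Lemma mon0 : mon k (0 : G) = 1. Proof. by []. Qed.

Lemma monD x y : mon k (x + y) = mon k x * mon k y.
Proof. by rewrite -[RHS]/(gmul _ _) gmulUU mulr1. Qed.

Lemma monMn x m : mon k (x *+ m) = mon k x ^+ m.
Proof. by elim: m => [|m IH]; rewrite ?mulr0n // mulrS exprS monD IH. Qed.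

Lemma mulr_monN x f : f * mon k (- x) * mon k x = f.
Proof. by rewrite -mulrA -monD addNr mulr1. Qed.

Lemma mulIr_mon x : injective (fun f => f * mon k x).
Proof.
move=> f g /(congr1 (fun u => u * mon k (- x))).
by rewrite -!mulrA -monD subrr !mulr1.
Qed.

Lemma mkmalgUE x (c : k) : mkmalgU x c = c *: mon k x :> grpalg k G.
Proof.
apply/malgP => z; rewrite (mcoeffZ c (mon k x)) /mon !mcoeffU.
by case: eqP => _; rewrite ?mulr1 ?mulr0 // mulr0n mulr0.
Qed.

Lemma grpalgE f : f = \sum_(z <- msupp f) mcoeff z f *: mon k z.
Proof.
by rewrite [LHS]monalgE; apply: eq_bigr => z _; rewrite mkmalgUE.
Qed.

Lemma mcoeff_mon x z : mcoeff z (mon k x) = (x == z)%:R.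
Proof. exact: mcoeffU. Qed.

Lemma msupp_mon x z : (z \in msupp (mon k x)) = (z == x).
Proof.
rewrite -mcoeff_neq0 mcoeff_mon [z == x]eq_sym.
by case: (x == z); rewrite /= ?oner_eq0 ?eqxx.
Qed.

Lemma mon_inj : injective (@mon k G).
Proof.
by move=> x y E; have := msupp_mon y x; rewrite -E msupp_mon eqxx => /esym/eqP.
Qed.

Lemma mcoeffM_mon x f z : mcoeff z (f * mon k x) = mcoeff (z - x) f.
Proof.
rewrite [f in LHS]grpalgE mulr_suml [f in RHS]grpalgE !raddf_sum.
apply: eq_bigr => y _ /=; rewrite -scalerAl -monD.
rewrite (mcoeffZ _ (mon k (y + x))) (mcoeffZ _ (mon k y)) !mcoeff_mon.
by rewrite [y == _]eq_sym subr_eq [z == _]eq_sym.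
Qed.

(** Linear conditions on an element of the group algebra are imposed through
    its support; such conditions form a submodule. *)
Definition supp_in (S : set G) f : Prop := forall z, z \in msupp f -> S z.

Lemma supp_inP (S : set G) f :
  (forall z, ~ S z -> mcoeff z f = 0) <-> supp_in S f.
Proof.
split=> [H z | H z Sz].
  by rewrite -mcoeff_neq0 => nz; apply: contrapT => /H E; rewrite E eqxx in nz.
by apply: mcoeff_outdom; apply/negP => /H.
Qed.

Lemma supp_in0 S : supp_in S 0.
Proof. by apply/supp_inP => z _; rewrite mcoeff0. Qed.

Lemma supp_inD S f g : supp_in S f -> supp_in S g -> supp_in S (f + g).
Proof.
move=> /supp_inP Hf /supp_inP Hg; apply/supp_inP => z nz.
by rewrite mcoeffD Hf // Hg // addr0.
Qed.

Lemma supp_inZ S c f : supp_in S f -> supp_in S (c *: f).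
Proof.
move=> /supp_inP Hf; apply/supp_inP => z nz.
by rewrite (mcoeffZ c f) Hf // mulr0.
Qed.

Lemma supp_inN S f : supp_in S f -> supp_in S (- f).
Proof. by rewrite -scaleN1r; apply: supp_inZ. Qed.

Lemma supp_in_sum S I (r : seq I) (P : pred I) (F : I -> grpalg k G) :
  (forall i, P i -> supp_in S (F i)) -> supp_in S (\sum_(i <- r | P i) F i).
Proof.
by move=> H; apply: big_ind => //; [apply: supp_in0 | move=> *; apply: supp_inD].
Qed.

Lemma supp_in_mon (S : set G) x : S x -> supp_in S (mon k x).
Proof. by move=> Sx z; rewrite msupp_mon => /eqP ->. Qed.

Lemma supp_inM (S1 S2 S : set G) f g :
  (forall x y, S1 x -> S2 y -> S (x + y)) ->
  supp_in S1 f -> supp_in S2 g -> supp_in S (f * g).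
Proof. by move=> H Hf Hg z /Defs.msuppM_le[x [y [/Hf ? /Hg ? ->]]]; apply: H. Qed.

Lemma supp_inX (S : nat -> set G) f m :
  S 0%N 0 -> (forall i x y, S 1%N x -> S i y -> S i.+1 (x + y)) ->
  supp_in (S 1%N) f -> supp_in (S m) (f ^+ m).
Proof.
move=> S0 SS Hf; elim: m => [|m IH]; first exact: supp_in_mon.
by rewrite exprS; apply: supp_inM Hf IH; apply: SS.
Qed.

End Monomials.

(** * Linear extension of maps defined on monomials *)

Section LinearExtension.
Context (k : comNzRingType) (G : zmodType) (B : lmodType k) (phi : G -> B).

Definition lin (f : grpalg k G) : B := \sum_(z <- msupp f) mcoeff z f *: phi z.

Lemma linw (d : {fset G}) (f : grpalg k G) : (msupp f `<=` d)%fset ->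
  lin f = \sum_(z <- d) mcoeff z f *: phi z.
Proof.
move=> le; apply: big_fset_incl => // z _ /mcoeff_outdom ->.
by rewrite scale0r.
Qed.

Lemma lin_is_linear : linear lin.
Proof.
move=> c f g; set d := (msupp f `|` msupp g)%fset.
rewrite (linw (d := d) (f := f)) ?fsubsetUl //.
rewrite (linw (d := d) (f := g)) ?fsubsetUr //.
rewrite (linw (d := d)); last first.
  apply: fsubset_trans (msuppD_le _ _) _.
  exact: fsetUSS (msuppZ_le _ _) (fsubset_refl _).
rewrite scaler_sumr -big_split; apply: eq_bigr => z _ /=.
by rewrite mcoeffD (mcoeffZ c f) scalerDl scalerA.
Qed.

HB.instance Definition _ :=
  GRing.isLinear.Build k (grpalg k G) B *:%R lin lin_is_linear.

Lemma lin_mon z : lin (mon k z) = phi z.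
Proof.
rewrite (linw (d := [fset z]%fset)) ?msuppU_le // big_seq_fset1.
by rewrite mcoeff_mon eqxx scale1r.
Qed.

End LinearExtension.

Section LinearExtensionTheory.
Context (k : comNzRingType) (G : zmodType).

Lemma eq_lin (B : lmodType k) (S : set G) (phi psi : G -> B) (f : grpalg k G) :
  supp_in S f -> (forall z, S z -> phi z = psi z) -> lin phi f = lin psi f.
Proof.
move=> Sf E; rewrite /lin big_seq [RHS]big_seq.
by apply: eq_bigr => z /Sf /E ->.
Qed.

Lemma lin_id (f : grpalg k G) : lin (@mon k G) f = f.
Proof. by rewrite [RHS]grpalgE. Qed.

Lemma lin_raddf (B C : lmodType k) (u : {linear B -> C}) (phi : G -> B)
  (f : grpalg k G) : u (lin phi f) = lin (u \o phi) f.
Proof. by rewrite /lin linear_sum; apply: eq_bigr => z _; rewrite linearZ_LR. Qed.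

Lemma supp_in_lin (S T : set G) (phi : G -> grpalg k G) (f : grpalg k G) :
  supp_in S f -> (forall z, S z -> supp_in T (phi z)) -> supp_in T (lin phi f).
Proof.
move=> Sf H; rewrite /lin big_seq.
by apply: supp_in_sum => z /Sf Sz; apply: supp_inZ; apply: H.
Qed.

(** Multiplicativity is asked on a subset S only, because the maps in use are
    multiplicative on a semigroup and not on the whole group. *)
Lemma linM (B : comAlgType k) (S : set G) (phi : G -> B) (f g : grpalg k G) :
  (forall x y, S x -> S y -> phi (x + y) = phi x * phi y) ->
  supp_in S f -> supp_in S g -> lin phi (f * g) = lin phi f * lin phi g.
Proof.
move=> phiM Sf Sg; rewrite [f in LHS]grpalgE [g in LHS]grpalgE.
rewrite mulr_suml raddf_sum [lin phi f]/lin mulr_suml /= big_seq [RHS]big_seq.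
apply: eq_bigr => x /Sf Sx; rewrite mulr_sumr raddf_sum [lin phi g]/lin mulr_sumr.
rewrite /= big_seq [RHS]big_seq; apply: eq_bigr => y /Sg Sy.
rewrite -scalerAl -scalerAr -monD !linearZ /= lin_mon phiM //.
by rewrite -scalerAl -scalerAr.
Qed.

End LinearExtensionTheory.
(** * Leading monomials *)

Section LeadingMonomials.
Context (n : nat).

(** Polynomials are a convenient additive copy of the group with a leading
    coefficient at hand. *)
Definition amb_poly (z : amb n) : {poly int} := rVpoly z.1 * 'X + z.2%:P.

Lemma amb_polyD y z : amb_poly (y + z) = amb_poly y + amb_poly z.
Proof. by rewrite /amb_poly raddfD polyCD mulrDl addrACA. Qed.

Lemma amb_polyN z : amb_poly (- z) = - amb_poly z.
Proof. by rewrite /amb_poly raddfN polyCN mulNr opprD. Qed.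

Lemma amb_poly_eq0 z : amb_poly z = 0 -> z = 0.
Proof.
case: z => x d /polyP E; congr (_, _).
  apply: (can_inj rVpolyK); apply/polyP => i; rewrite raddf0 coef0.
  by have := E i.+1; rewrite coefD coefMX coefC coef0 /= addr0.
by have := E 0%N; rewrite coefD coefMX coefC coef0 /= add0r.
Qed.

(** Any total order on the group that is compatible with the addition would
    do; this one is lexicographic, by the sign of the last nonzero coordinate,
    the degree coming first. *)
Definition posamb (z : amb n) : bool := 0 < lead_coef (amb_poly z).

Lemma posambD y z : posamb y -> posamb z -> posamb (y + z).
Proof.
rewrite /posamb amb_polyD; move: (amb_poly y) (amb_poly z) => p q p0 q0.
case: (ltngtP (size p) (size q)) => E.
- by rewrite lead_coefDr.
- by rewrite lead_coefDl.
have pq0 : 0 < (p + q)`_(size p).-1 by rewrite coefD {2}E addr_gt0.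
suff -> : lead_coef (p + q) = (p + q)`_(size p).-1 by [].
have p_gt0 : (0 < size p)%N.
  by rewrite size_poly_gt0; apply: contraTneq p0 => ->; rewrite lead_coef0.
rewrite lead_coefE; congr (_`_ _.-1); apply/eqP; rewrite eqn_leq.
apply/andP; split; first by apply: leq_trans (size_polyD _ _) _; rewrite -E maxnn.
rewrite leqNgt; apply/negP => lt; move: pq0.
by rewrite nth_default ?ltxx // -ltnS prednK.
Qed.

Lemma posamb0 : posamb 0 = false.
Proof.
by rewrite /posamb (_ : amb_poly 0 = 0) ?lead_coef0 // /amb_poly raddf0 mul0r addr0.
Qed.

Lemma posamb_total z : z != 0 -> posamb z || posamb (- z).
Proof.
move=> nz; rewrite /posamb amb_polyN lead_coefN oppr_gt0 orbC -neq_lt.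
by rewrite lead_coef_eq0; apply: contraNneq nz => /amb_poly_eq0 ->.
Qed.

Lemma posambN z : posamb z -> ~~ posamb (- z).
Proof. by move=> pz; apply/negP => /(posambD pz); rewrite subrr posamb0. Qed.

Context (k : idomainType).
Implicit Types f g : grpalg k (amb n).

Definition leading f a : Prop :=
  a \in msupp f /\ forall z, z \in msupp f -> z != a -> posamb (a - z).

Lemma leading_exists f : f != 0 -> exists a, leading f a.
Proof.
move=> nz; have {nz} : enum_fset (msupp f) != [::].
  by apply: contra_neq nz => E; rewrite [f]grpalgE E big_nil.
suff H (s : seq (amb n)) : s != [::] ->
    exists a, a \in s /\ forall z, z \in s -> z != a -> posamb (a - z).
  exact: H.
elim: s => // x [|y s] IH _.
  by exists x; split=> [|z]; rewrite inE // => ->.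
have [//|a [sa Ha]] := IH; have [->|xa] := eqVneq x a.
  exists a; split=> [|z]; first by rewrite inE eqxx.
  by rewrite inE => /orP[->//|/Ha].
have /orP[ax|] : posamb (a - x) || posamb (- (a - x)).
- by apply: posamb_total; rewrite subr_eq0 eq_sym.
- exists a; split=> [|z]; first by rewrite inE sa orbT.
  by rewrite inE => /orP[/eqP->|/Ha].
rewrite opprB => xa0; exists x; split=> [|z]; first by rewrite inE eqxx.
rewrite inE => /orP[->//|sz] _; have [->//|za] := eqVneq z a.
by have := posambD xa0 (Ha z sz za); rewrite addrA subrK.
Qed.

Lemma leading_neq0 f a : leading f a -> f != 0.
Proof. by case=> fa _; apply: contraTneq fa => ->; rewrite msupp0. Qed.

Lemma leading_uniq f a b : leading f a -> leading f b -> a = b.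
Proof.
move=> [fa Ha] [fb Hb]; apply/eqP/contraT => ab.
have := posambN (Hb a fa ab); rewrite opprB Ha //.
by rewrite eq_sym.
Qed.

Lemma leading_mon z : leading (mon k z) z.
Proof. by split=> [|y]; rewrite msupp_mon // => ->. Qed.

(** No cancellation can occur at a + b: in any other decomposition of a + b one
    summand would exceed a or b. *)
Lemma leadingM f g a b : leading f a -> leading g b -> leading (f * g) (a + b).
Proof.
move=> [fa Ha] [gb Hb]; split; last first.
  move=> z /Defs.msuppM_le[x [y [fx gy ->]]].
  have -> : a + b - (x + y) = (a - x) + (b - y) by rewrite opprD addrACA.
  have [->|xa] := eqVneq x a; have [->|yb] := eqVneq y b.
  - by rewrite eqxx.
  - by rewrite subrr add0r => _; apply: Hb.
  - by rewrite subrr addr0 => _; apply: Ha.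
  - by move=> _; apply: posambD; [apply: Ha|apply: Hb].
have coefE x : mcoeff (a + b) (mcoeff x f *: mon k x * g) =
    mcoeff x f * mcoeff (a + b - x) g.
  by rewrite -scalerAl mulrC (mcoeffZ _ (g * mon k x)) mcoeffM_mon.
have sumE : mcoeff (a + b) (f * g) =
    \sum_(x <- msupp f) mcoeff x f * mcoeff (a + b - x) g.
  rewrite [f in LHS]grpalgE mulr_suml raddf_sum.
  by apply: eq_bigr => x _; apply: coefE.
rewrite -mcoeff_neq0 sumE (bigD1_seq a fa (fset_uniq _)) /=.
rewrite [a + b]addrC addrK big_seq_cond big1 ?addr0.
  by rewrite mulf_neq0 ?mcoeff_neq0.
move=> x /andP[fx xa]; rewrite [b + a]addrC.
have [gx|/mcoeff_outdom ->] := boolP (a + b - x \in msupp g); last by rewrite mulr0.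
have abE : b - (a + b - x) = x - a by rewrite opprB addrC -addrA opprD addrNK.
have := Hb _ gx; rewrite abE -subr_eq0 -oppr_eq0 opprB abE subr_eq0.
by move=> /(_ xa) /posambN; rewrite opprB Ha.
Qed.

Lemma leadingX f a m : leading f a -> leading (f ^+ m) (a *+ m).
Proof.
move=> fa; elim: m => [|m IH]; first exact: leading_mon.
by rewrite exprS mulrS; apply: leadingM.
Qed.

Lemma grpalg_mulf_eq0 f g : f * g = 0 -> f = 0 \/ g = 0.
Proof.
move=> fg; have [->|/leading_exists[a fa]] := eqVneq f 0; first by left.
have [->|/leading_exists[b gb]] := eqVneq g 0; first by right.
by have := leading_neq0 (leadingM fa gb); rewrite fg eqxx.
Qed.

Lemma grpalg_expf_eq0 f m : f ^+ m = 0 -> f = 0.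
Proof.
have [->//|/leading_exists[a /(leadingX m)/leading_neq0]] := eqVneq f 0.
by move=> nz E; rewrite E eqxx in nz.
Qed.

End LeadingMonomials.
(** * Polytopal algebras *)

Section PolytopalSupport.
Context (k : fieldType) (R : realType) (n : nat) (P : set 'rV[R]_n).

Lemma polyalg_supp (f : polyalg k P) : supp_in (semigp P) (polyalg_val f).
Proof. by case: f => f /= /asboolP. Qed.

Lemma supportedP (f : grpalg k (amb n)) :
  reflect (supp_in (semigp P) f) (f \in supported P).
Proof. exact: asboolP. Qed.

End PolytopalSupport.
Arguments polyalg_supp {k R n P} f [z].

Section PolytopalMorphism.
Context (k : fieldType) (R : realType) (n : nat) (P Q : set 'rV[R]_n).

Context (phi : amb n -> grpalg k (amb n)).
Hypothesis phiQ : forall z, semigp P z -> supp_in (semigp Q) (phi z).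
Hypothesis phi0 : phi 0 = 1.
Hypothesis phiD : forall y z, semigp P y -> semigp P z ->
  phi (y + z) = phi y * phi z.

Lemma polyext_subproof (f : polyalg k P) : lin phi (polyalg_val f) \in supported Q.
Proof. by apply/supportedP; apply: supp_in_lin (polyalg_supp f) phiQ. Qed.

Definition polyext (f : polyalg k P) : polyalg k Q :=
  PolyAlg (polyext_subproof f).

Lemma polyext_is_linear : linear polyext.
Proof. by move=> c f g; apply: val_inj; apply: lin_is_linear. Qed.

Lemma polyext_is_monoid_morphism : monoid_morphism polyext.
Proof.
split=> [|f g]; apply: val_inj; first by rewrite /= -[RHS]phi0; apply: lin_mon.
exact: linM phiD (polyalg_supp f) (polyalg_supp g).
Qed.

HB.instance Definition _ :=
  GRing.isLinear.Build k (polyalg k P) (polyalg k Q) *:%R polyext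
    polyext_is_linear.
HB.instance Definition _ :=
  GRing.isMonoidMorphism.Build (polyalg k P) (polyalg k Q) polyext
    polyext_is_monoid_morphism.

(** The morphisms below are built from their values on monomials. *)
Lemma polyalg_lrmorphism : exists e : {lrmorphism polyalg k P -> polyalg k Q},
  forall f, polyalg_val (e f) = lin phi (polyalg_val f).
Proof. by exists polyext. Qed.

End PolytopalMorphism.

Section PolytopalAlgebraTheory.
Context (k : fieldType) (R : realType) (n : nat).
Implicit Types P Q : set 'rV[R]_n.

Lemma semigpMn P z m : semigp P z -> semigp P (z *+ m).
Proof.
move=> Pz; elim: m => [|m IH]; first exact: semigp0.
by rewrite mulrS; apply: semigpD.
Qed.

Lemma semigpS P Q z : Q `<=` P -> semigp Q z -> semigp P z.
Proof. by move=> QP [s sQ ->]; exists s => // x /sQ /QP. Qed.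

Lemma semigp_ind P (S : set (amb n)) :
  S 0 -> (forall y z, semigp P y -> semigp P z -> S y -> S z -> S (y + z)) ->
  (forall x, lattice_points P x -> S (deg1 x)) -> forall z, semigp P z -> S z.
Proof.
move=> S0 SD S1 z [s sP ->].
suff [] : semigp P (\sum_(x <- s) deg1 x) /\ S (\sum_(x <- s) deg1 x) by [].
elim: s sP => [|x s IH] sP; first by rewrite big_nil; split; first exact: semigp0.
have Px : lattice_points P x by apply: sP; rewrite inE eqxx.
have [|Ps Ss] := IH; first by move=> y sy; apply: sP; rewrite inE sy orbT.
by rewrite big_cons; split; [apply: semigpD | apply: SD => //; last exact: S1];
  rewrite //; apply: semigp_deg1.
Qed.

(** The degree counts the generators in a sum, so an element of degree 1 is a
    generator. *)
Lemma semigp_homog1 P x : semigp P (deg1 x) -> lattice_points P x.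
Proof.
case=> s sP E; suff : size s = 1%N.
  case: s sP E => // y [|//] sP; rewrite big_seq1 => -[->] _.
  by apply: sP; rewrite inE eqxx.
have : (\sum_(y <- s) deg1 y).2 = (size s)%:Z.
  elim: s {sP E} => [|y s IH]; rewrite ?big_nil // big_cons /= IH.
  exact: esym (intS _).
by rewrite -E => -[].
Qed.

Lemma polyalg_ind P (S : set (amb n)) (T : set (polyalg k P)) : T 0 ->
  (forall c f g, T f -> T g -> T (c *: f + g)) ->
  (forall z (Pz : semigp P z), S z -> T (pmon k Pz)) ->
  forall f, supp_in S (polyalg_val f) -> T f.
Proof.
move=> T0 TD T1 f Sf.
have H (s : seq (amb n)) : (forall z, z \in s -> semigp P z /\ S z) ->
    exists2 g, T g &
      polyalg_val g = \sum_(z <- s) mcoeff z (polyalg_val f) *: mon k z.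
  elim: s => [|z s IH] sP; first by exists 0; rewrite ?big_nil.
  have [y sy|g Tg gE] := IH; first by apply: sP; rewrite inE sy orbT.
  have [|Pz Sz] := sP z; first by rewrite inE eqxx.
  exists (mcoeff z (polyalg_val f) *: pmon k Pz + g).
    by apply: TD => //; apply: T1.
  by rewrite big_cons -gE.
have [|g Tg gE] := H (msupp (polyalg_val f)).
  by move=> z fz; split; [apply: polyalg_supp fz | apply: Sf].
suff -> : f = g by [].
by apply: val_inj; rewrite /= gE -grpalgE.
Qed.

Lemma eq_polyalg_linear P (B : lmodType k) (u v : {linear polyalg k P -> B}) :
  (forall z (Pz : semigp P z), u (pmon k Pz) = v (pmon k Pz)) -> u =1 v.
Proof.
move=> uv f; pose T : set (polyalg k P) := [set g | u g = v g].
apply: (@polyalg_ind _ setT T) => //; rewrite /T /=; first by rewrite !raddf0.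
  by move=> c g h ug vg; rewrite !linearP ug vg.
by move=> z Pz _; apply: uv.
Qed.

End PolytopalAlgebraTheory.
(** * Chains of prime ideals *)

Section KrullDimension.
Context (k : fieldType) (R : realType) (n : nat) (P : set 'rV[R]_n).

Definition truncate (i : nat) (z : amb n) : amb n :=
  (\row_j (if (j < i)%N then 0 else z.1 0 j), if (i <= n)%N then z.2 else 0).

Lemma truncateD i y z : truncate i (y + z) = truncate i y + truncate i z.
Proof.
congr (_, _); last by rewrite /=; case: ifP => // _; rewrite addr0.
by apply/rowP => j; rewrite !mxE; case: ifP => // _; rewrite addr0.
Qed.

Lemma truncate0 i : truncate i 0 = 0.
Proof. by apply: (addrI (truncate i 0)); rewrite -truncateD !addr0. Qed.

Lemma truncateN i z : truncate i (- z) = - truncate i z.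
Proof. by apply/eqP; rewrite -addr_eq0 -truncateD addNr truncate0. Qed.

Lemma truncateK i z : truncate i.+1 (truncate i z) = truncate i.+1 z.
Proof.
congr (_, _) => /=; last by case: ifP => // /ltnW ->.
by apply/rowP => j; rewrite !mxE ltnS leq_eqVlt orbC; case: (j < i)%N.
Qed.

(** The subgroups on which the truncations vanish increase strictly. *)
Lemma truncate_witness i : (i < n.+1)%N ->
  exists2 z, truncate i.+1 z = 0 & truncate i z != 0.
Proof.
rewrite ltnS leq_eqVlt => /orP[/eqP ->|lt_in].
  exists (0, 1); last by rewrite /truncate leqnn xpair_eqE andbC.
  congr (_, _); last by rewrite /= ltnn.
  by apply/rowP => j; rewrite !mxE; case: ifP.
exists (delta_mx 0 (Ordinal lt_in), 0).
  congr (_, _) => /=; last by case: ifP.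
  apply/rowP => j; rewrite !mxE ltnS; case: leqP => //= lt_ij.
  by rewrite -val_eqE /= gtn_eqF ?andbF.
apply/eqP => -[/rowP /(_ (Ordinal lt_in)) E _]; move: E.
by rewrite !mxE ltnn !eqxx.
Qed.

Definition truncalg i : grpalg k (amb n) -> grpalg k (amb n) :=
  lin (@mon k _ \o truncate i).

Lemma truncalg_mon i z : truncalg i (mon k z) = mon k (truncate i z).
Proof. exact: lin_mon. Qed.

Lemma truncalgB i f g : truncalg i (f - g) = truncalg i f - truncalg i g.
Proof. exact: raddfB. Qed.

Lemma truncalgM i f g : truncalg i (f * g) = truncalg i f * truncalg i g.
Proof.
apply: (linM (S := setT)) => // x y _ _.
by rewrite /= truncateD monD.
Qed.

Lemma truncalgK i f : truncalg i f = 0 -> truncalg i.+1 f = 0.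
Proof.
move=> f0; suff -> : truncalg i.+1 f = truncalg i.+1 (truncalg i f).
  by rewrite f0 [LHS]raddf0.
rewrite /truncalg [RHS]lin_raddf; apply: (eq_lin (S := setT)) => // z _ /=.
by rewrite lin_mon /= truncateK.
Qed.

(** The kernels of the maps that set more and more variables to 1 are prime,
    since group algebras of free abelian groups are domains, and they are
    distinct because S_P generates Z^(n+1). *)
Lemma prime_chain_polyalg : gp P = setT ->
  prime_chain [set: polyalg k P] n.+1.
Proof.
move=> gpT.
exists (fun i => [set f | truncalg i (polyalg_val f) = 0]); split=> i i_lt.
  split=> [|/= f1|f g /= f0 g0|f g _ /= g0|f g _ _ /=].
  - by split=> // ; rewrite /= [LHS]raddf0.
  - have := oner_neq0 (grpalg k (amb n)); rewrite -f1 /=.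
    by rewrite -mon0 truncalg_mon truncate0 eqxx.
  - by rewrite truncalgB f0 g0 subrr.
  - by rewrite truncalgM g0 mulr0.
  - by rewrite truncalgM => /grpalg_mulf_eq0.
split=> [f|/= sub]; first exact: truncalgK.
have [z z0 /eqP] := truncate_witness i_lt; apply.
have : gp P z by rewrite gpT.
case=> a [b [Pa Pb zE]]; rewrite zE truncateD truncateN; apply/eqP.
rewrite subr_eq0; apply/eqP; apply: (@mon_inj k).
pose f := pmon k Pa - pmon k Pb.
have fE j : truncalg j (polyalg_val f) = mon k (truncate j a) - mon k (truncate j b).
  by rewrite -!truncalg_mon -truncalgB.
have /(sub f) : truncalg i.+1 (polyalg_val f) = 0.
  rewrite fE; apply/eqP; rewrite subr_eq0; apply/eqP; congr mon; apply/eqP.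
  by rewrite -subr_eq0 -truncateN -truncateD -zE z0.
by move=> fi; apply: subr0_eq; rewrite -fE; apply: fi.
Qed.

End KrullDimension.
(** * Linear forms vanishing on n vectors *)

Section DeterminantForm.
Context (A : comNzRingType) (n : nat) (Q : 'M[A]_(n, 1 + n)).

Definition detform (v : 'rV[A]_(1 + n)) : A := \det (col_mx v Q).

Definition detcoef : 'cV[A]_(1 + n) :=
  \col_j cofactor (col_mx (0 : 'rV_(1 + n)) Q) 0 j.

Lemma detformE v : detform v = (v *m detcoef) 0 0.
Proof.
rewrite /detform (expand_det_row _ 0) mxE; apply: eq_bigr => j _.
have z0 : (0 : 'I_(1 + n)) = lshift n 0 by apply: val_inj.
congr (_ * _); first by rewrite -(col_mxEu v Q 0 j) -z0.
rewrite mxE /cofactor; congr (_ * \det _); apply/matrixP => i l; rewrite !mxE.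
have -> : lift 0 i = rshift 1 i by apply: val_inj.
by rewrite (unsplitK (inr i)).
Qed.

Lemma detformD u v : detform (u + v) = detform u + detform v.
Proof. by rewrite !detformE mulmxDl mxE. Qed.

Lemma detformZ a v : detform (a *: v) = a * detform v.
Proof. by rewrite !detformE -scalemxAl mxE. Qed.

Lemma detform_row i : detform (row i Q) = 0.
Proof.
apply: (determinant_alternate (i1 := lshift n 0) (i2 := rshift 1 i)).
  by rewrite eq_lrshift.
by move=> j; rewrite col_mxEu col_mxEd mxE.
Qed.

Lemma detform_mulmx (b : 'rV_n) : detform (b *m Q) = 0.
Proof.
rewrite mulmx_sum_row; apply: (big_ind (fun v => detform v = 0)).
- by rewrite detformE mul0mx mxE.
- by move=> u v u0 v0; rewrite detformD u0 v0 addr0.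
- by move=> i _; rewrite detformZ detform_row mulr0.
Qed.

End DeterminantForm.

Section Cramer.
Context (A : idomainType) (n : nat) (Q : 'M[A]_(n, 1 + n)).

(** Cramer's rule, without denominators so that it also serves over Z. *)
Lemma detform_cramer q v : detform Q q != 0 ->
  exists b : 'rV_n, detform Q q *: v = detform Q v *: q + b *m Q.
Proof.
move=> nz; set w := v *m \adj (col_mx q Q).
have wE : detform Q q *: v = lsubmx w 0 0 *: q + rsubmx w *m Q.
  rewrite -mul_mx_scalar -mul_adj_mx mulmxA -/w -{1}[w]hsubmxK mul_row_col.
  by rewrite {1}[lsubmx w]mx11_scalar mul_scalar_mx.
exists (rsubmx w); rewrite {1}wE; congr (_ *: _ + _).
have := congr1 (detform Q) wE.
by rewrite detformD !detformZ detform_mulmx addr0 mulrC => /(mulIf nz) ->.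
Qed.

End Cramer.

Section DetformMap.
Context (A B : comNzRingType) (f : {rmorphism A -> B}) (n : nat).

Lemma detform_map (Q : 'M[A]_(n, 1 + n)) v :
  detform (map_mx f Q) (map_mx f v) = f (detform Q v).
Proof. by rewrite /detform -map_col_mx det_map_mx. Qed.

End DetformMap.

Section FreeRows.
Context (K : fieldType).

Lemma row_free_rowsub m p q (A : 'M[K]_(m, q)) (s : 'I_p -> 'I_m) :
  injective s -> row_free A -> row_free (rowsub s A).
Proof.
move=> s_inj /row_freeP[B AB]; apply/row_freeP.
exists (B *m (rowsub s 1%:M)^T).
have -> : rowsub s A = rowsub s 1%:M *m A by rewrite mul_rowsub_mx mul1mx.
rewrite mulmxA -(mulmxA _ A) AB mulmx1; apply/matrixP => i j.
rewrite !mxE (bigD1 (s i)) //= !mxE eqxx mul1r big1 ?addr0 => [|l /negPf li].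
  by rewrite (inj_eq s_inj) eq_sym.
by rewrite !mxE eq_sym li mul0r.
Qed.

Lemma row_free_submatrix m p q (A : 'M[K]_(m, q)) : (p <= \rank A)%N ->
  exists s : 'I_p -> 'I_m, row_free (rowsub s A).
Proof.
move=> le; exists (maxrankfun A \o widen_ord le).
have -> : rowsub (maxrankfun A \o widen_ord le) A =
    rowsub (widen_ord le) (rowsub (maxrankfun A) A).
  by apply/matrixP => i j; rewrite !mxE.
apply: row_free_rowsub (maxrowsub_free A).
by move=> i j /(congr1 val) /= /val_inj.
Qed.

Lemma row_free_detform n (Q : 'M[K]_(n, 1 + n)) v :
  row_free Q -> ~~ (v <= Q)%MS -> detform Q v != 0.
Proof.
move=> Qfree vQ; rewrite -unitfE -[_ \is a _]unitmxE -row_free_unit.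
apply: inj_row_free => w; rewrite -[w]hsubmxK mul_row_col.
rewrite {1}[lsubmx w]mx11_scalar mul_scalar_mx.
have [a0 | a0] := eqVneq (lsubmx w 0 0) 0.
  rewrite a0 scale0r add0r => /eqP; rewrite mulmx_free_eq0 // => /eqP ->.
  by rewrite [lsubmx w]mx11_scalar a0 raddf0 row_mx0.
move=> E; case/negP: vQ; apply/submxP; exists (- (lsubmx w 0 0)^-1 *: rsubmx w).
apply: (scalerI a0).
by rewrite -scalemxAl scalerA mulrN divff // scaleN1r; apply/eqP; rewrite -addr_eq0 E.
Qed.

Lemma detform_neq0_exists n (Q : 'M[K]_(n, 1 + n)) : row_free Q ->
  exists i, detform Q (delta_mx 0 i) != 0.
Proof.
move=> Qfree.
have : ~~ ((1%:M : 'M[K]_(1 + n)) <= Q)%MS.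
  apply/negP => /mxrankS; rewrite mxrank1 => le.
  by have := leq_trans le (rank_leq_row Q); rewrite ltnn.
case/row_subPn => i; rewrite row1 => eiQ; exists i.
exact: row_free_detform.
Qed.

End FreeRows.
(** * Convex sets *)

Section Convexity.
Context (R : realType) (n : nat).
Implicit Types (P Q F H : set 'rV[R]_n).

(** The coordinate 1 comes first: this turns affine questions about points into
    linear ones, and matches the shape of [detform]. *)
Definition homog_row (x : 'rV[R]_n) : 'rV[R]_(1 + n) := row_mx 1%:M x.

Definition homog_mx (m : nat) (p : 'I_m -> 'rV[R]_n) : 'M[R]_(m, 1 + n) :=
  \matrix_i homog_row (p i).

Lemma mulmx_homog m (p : 'I_m -> 'rV[R]_n) (w : 'rV[R]_m) :
  w *m homog_mx p = row_mx (\sum_i w 0 i)%:M (\sum_i w 0 i *: p i).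
Proof.
rewrite mulmx_sum_row.
have -> : \sum_i w 0 i *: row i (homog_mx p) =
    \sum_i row_mx (w 0 i)%:M (w 0 i *: p i).
  apply: eq_bigr => i _.
  by rewrite rowK /homog_row scale_row_mx scale_scalar_mx mulr1.
rewrite -[LHS]hsubmxK !linear_sum /=; congr row_mx.
  by rewrite raddf_sum; apply: eq_bigr => i _; rewrite row_mxKl.
by apply: eq_bigr => i _; rewrite row_mxKr.
Qed.

Definition convex_set P : Prop := forall (t : R) x y,
  0 <= t <= 1 -> P x -> P y -> P ((1 - t) *: x + t *: y).

(** The weights of the iterated combination are the products of the weights. *)
Lemma conv_hull_sum m (p : 'I_m -> 'rV[R]_n) s (a : 'I_s -> 'rV[R]_n) w :
  (forall i, conv_hull p (a i)) -> (forall i, 0 <= w i) -> \sum_i w i = 1 ->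
  conv_hull p (\sum_i w i *: a i).
Proof.
move=> /choice[u Hu] w0 w1.
exists (fun j => \sum_i w i * u i j); split.
- by move=> j; apply: sumr_ge0 => i _; apply: mulr_ge0 => //; case: (Hu i).
- rewrite exchange_big /= -w1; apply: eq_bigr => i _.
  by case: (Hu i) => _ E _; rewrite -mulr_sumr E mulr1.
transitivity (\sum_i \sum_j (w i * u i j) *: p j).
  apply: eq_bigr => i _; case: (Hu i) => _ _ ->.
  by rewrite scaler_sumr; apply: eq_bigr => j _; rewrite scalerA.
by rewrite exchange_big; apply: eq_bigr => j _; rewrite scaler_suml.
Qed.

Lemma conv_hull_convex m (p : 'I_m -> 'rV[R]_n) : convex_set (conv_hull p).
Proof.
move=> t x y /andP[t0 t1] px py.
pose a (i : 'I_2) := if i == 0 then x else y.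
pose w (i : 'I_2) := if i == 0 then 1 - t else t.
have -> : (1 - t) *: x + t *: y = \sum_i w i *: a i.
  by rewrite big_ord_recl big_ord1.
apply: conv_hull_sum => [i|i|]; rewrite /a /w.
- by case: ifP.
- by case: ifP => // _; rewrite subr_ge0.
- by rewrite big_ord_recl big_ord1 /= subrK.
Qed.

Lemma lattice_polytope_convex P : lattice_polytope P -> convex_set P.
Proof. by case=> m [p ->]; apply: conv_hull_convex. Qed.

Lemma affine_subspace_sum H m (p : 'I_m -> 'rV[R]_n) (c : 'I_m -> R) :
  affine_subspace H -> (forall i, H (p i)) -> \sum_i c i = 1 ->
  H (\sum_i c i *: p i).
Proof.
move=> Haff Hp c1.
have [x0 Hx0] : exists x0, H x0.
  case: m p c Hp c1 => [|m] p c Hp c1; last by exists (p 0).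
  by move/eqP: c1; rewrite big_ord0 eq_sym oner_eq0.
pose V := [set u | H (x0 + u)].
have VZ t u : V u -> V (t *: u).
  rewrite /V /= => Hu; have -> : x0 + t *: u = (1 - t) *: x0 + t *: (x0 + u).
    by rewrite scalerDr addrA -scalerDl subrK scale1r.
  exact: Haff.
have VD u v : V u -> V v -> V (u + v).
  move=> Vu Vv; rewrite /V /=.
  have -> : x0 + (u + v) =
      (1 - 2^-1) *: (x0 + 2 *: u) + 2^-1 *: (x0 + 2 *: v).
    rewrite !scalerDr addrACA -scalerDl subrK scale1r !scalerA mulVf ?pnatr_eq0 //.
    have -> : (1 - 2^-1) * 2 = 1 :> R.
      by rewrite mulrBl mul1r mulVf ?pnatr_eq0 // -[2]/(1 + 1) addrK.
    by rewrite !scale1r.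
  by apply: Haff; apply: VZ.
have -> : \sum_i c i *: p i = x0 + \sum_i c i *: (p i - x0).
  under [in RHS]eq_bigr do rewrite scalerBr.
  by rewrite sumrB -scaler_suml c1 scale1r addrC subrK.
apply: (big_ind V) => //; last by move=> i _; apply: VZ; rewrite /V /= addrC subrK.
by rewrite /V /= addr0.
Qed.

(** The homothety of centre y that moves x to the given point carries a ball
    around x, contained in P, to a ball around that point. *)
Lemma interior_segment P x y (t : R) : convex_set P -> interior P x -> P y ->
  0 <= t < 1 -> interior P ((1 - t) *: x + t *: y).
Proof.
move=> Pconv /nbhs_ballP[e /= e0 xe] Py /andP[t0 t1].
have t1' : 0 < 1 - t by rewrite subr_gt0.
apply/nbhs_ballP; exists ((1 - t) * e); first exact: mulr_gt0.
move=> z [_ zb].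
pose u := x + (1 - t)^-1 *: (z - ((1 - t) *: x + t *: y)).
have -> : z = (1 - t) *: u + t *: y.
  rewrite /u scalerDr scalerA divff ?gt_eqF // scale1r.
  by rewrite addrAC addrC subrK.
apply: Pconv => //; first by rewrite t0 ltW.
apply: xe; split=> // i j; rewrite /ball /= /u !mxE.
rewrite opprD addrA subrr sub0r normrN normrM gtr0_norm ?invr_gt0 //.
rewrite mulrC ltr_pdivrMr // [e * _]mulrC -normrN opprB.
by have := zb i j; rewrite /ball /= !mxE.
Qed.

(** All weights of the barycentre are positive, and the weights of nearby points
    depend linearly on the displacement, so they stay positive. *)
Lemma interior_simplex P (p : 'I_(1 + n) -> 'rV[R]_n) :
  (forall (w : 'I_(1 + n) -> R), (forall i, 0 <= w i) -> \sum_i w i = 1 ->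
     P (\sum_i w i *: p i)) ->
  homog_mx p \in unitmx -> exists x, interior P x.
Proof.
move=> Pp unit_p; set B := invmx (homog_mx p).
pose c : R := (1 + n)%:R^-1.
have c0 : 0 < c by rewrite invr_gt0 ltr0n.
pose b : R := 1 + \sum_i \sum_j `|B i j|.
have b0 : 0 < b.
  by rewrite ltr_pwDl // sumr_ge0 // => i _; rewrite sumr_ge0.
exists (\sum_i c *: p i); apply/nbhs_ballP; exists (c / b); first exact: divr_gt0.
move=> y [_ yb]; set u := y - \sum_i c *: p i.
pose beta : 'rV[R]_(1 + n) := row_mx 0 u *m B.
have : beta *m homog_mx p = row_mx 0 u by rewrite mulmxKV.
rewrite mulmx_homog => /eq_row_mx[/matrixP/(_ 0 0) beta_sum beta_u].
have {}beta_sum : \sum_i beta 0 i = 0 by move: beta_sum; rewrite !mxE eqxx.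
have -> : y = \sum_i (c + beta 0 i) *: p i.
  under eq_bigr do rewrite scalerDl.
  by rewrite big_split /= beta_u addrC subrK.
apply: Pp; last first.
  rewrite big_split /= beta_sum addr0 sumr_const card_ord -mulr_natr.
  by rewrite /c mulVf // pnatr_eq0.
move=> i; rewrite -[c]opprK addrC subr_ge0 -lerN2 opprK.
apply: le_trans (ler_norm _) _; rewrite normrN.
have uB (j : 'I_(1 + n)) : `|(row_mx 0 u : 'rV[R]_(1 + n)) 0 j| <= c / b.
  rewrite mxE; case: splitP => l _; rewrite mxE.
    by rewrite normr0 ltW // divr_gt0.
  have := yb 0 l; rewrite /ball /= => /ltW; rewrite -normrN opprB.
  by rewrite !mxE.
rewrite mxE; apply: le_trans (ler_norm_sum _ _ _) _.
apply: (@le_trans _ _ (\sum_j c / b * `|B j i|)).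
  by apply: ler_sum => j _; rewrite normrM ler_wpM2r.
rewrite -mulr_sumr mulrAC ler_pdivrMr // ler_pM2l //.
apply: ler_wpDl => //; apply: ler_sum => j _.
by rewrite (bigD1 i) //= lerDl sumr_ge0.
Qed.

End Convexity.
(** * The height above a facet *)

Section AffineDimension.
Context (R : realType) (n : nat).
Implicit Types A : set 'rV[R]_n.

Lemma affdim_le A : affdim A <= n%:Z.
Proof.
rewrite /affdim lerBlDr -[n%:Z + 1]/((n + 1)%:Z) lez_nat addn1.
by apply/bigmax_leqP => m _; rewrite -ltnS.
Qed.

(** The maximum in [affdim] is attained, as the empty family is always
    allowed. *)
Lemma affdim_exists A m : affdim A = m%:Z - 1 ->
  exists p : 'I_m -> 'rV[R]_n, (forall i, A (p i)) /\ aff_indep p.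
Proof.
rewrite /affdim => /addIr[mE].
pose D := [pred l : 'I_n.+2 | `[< exists p : 'I_l -> 'rV[R]_n,
  (forall i, A (p i)) /\ aff_indep p >]].
have D0 : (0 < #|D|)%N.
  apply/card_gt0P; exists 0; apply/asboolP.
  by exists (fun=> 0); split=> [[]|c _ _ []].
have [l /asboolP Dl lE] := eq_bigmax_cond (fun l : 'I_n.+2 => l : nat) D0.
by rewrite -mE (_ : \max_(_ < _ | _) _ = l :> nat).
Qed.

Lemma aff_indep_row_free m (p : 'I_m -> 'rV[R]_n) :
  aff_indep p -> row_free (homog_mx p).
Proof.
move=> p_free; apply: inj_row_free => v; rewrite mulmx_homog => E.
have {E} /eq_row_mx[/matrixP/(_ 0 0)] : row_mx (\sum_i v 0 i)%:M
  (\sum_i v 0 i *: p i) = row_mx 0 0 by rewrite E row_mx0.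
rewrite !mxE eqxx => v0 vp0; apply/rowP => i.
by rewrite mxE; apply: (p_free (fun i => v 0 i)).
Qed.

End AffineDimension.

Section LatticePoints.
Context (R : realType) (n : nat).
Implicit Types P F : set 'rV[R]_n.

Definition zrow (z : amb n) : 'rV[int]_(1 + n) := row_mx z.2%:M z.1.

Lemma zrow_is_zmod_morphism : zmod_morphism zrow.
Proof. by move=> y z; rewrite /zrow raddfB /= opp_row_mx add_row_mx. Qed.

HB.instance Definition _ :=
  GRing.isZmodMorphism.Build (amb n) 'rV[int]_(1 + n) zrow zrow_is_zmod_morphism.

Lemma zrow_inj : injective zrow.
Proof.
move=> [x a] [y b] /eq_row_mx[/matrixP/(_ 0 0)] /=.
by rewrite !mxE eqxx !mulr1n => -> ->.
Qed.

Lemma map_zrow_deg1 x : map_mx intr (zrow (deg1 x)) = homog_row (of_int R x).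
Proof. by rewrite map_row_mx map_scalar_mx. Qed.

Lemma conv_hull_vertex m (p : 'I_m -> 'rV[R]_n) i : conv_hull p (p i).
Proof.
exists (fun j => (j == i)%:R); split=> [j||]; first exact: ler0n.
  by rewrite (bigD1 i) //= eqxx big1 ?addr0 // => j /negPf ->.
rewrite (bigD1 i) //= eqxx scale1r big1 ?addr0 // => j /negPf ->.
by rewrite scale0r.
Qed.

(** Points of F are combinations of the vertices, so the vertices have at least
    the rank of the given points; maximal independent families of vertices
    are large enough. *)
Lemma lattice_polytope_basis F m (p : 'I_m -> 'rV[R]_n) :
  lattice_polytope F -> (forall i, F (p i)) -> aff_indep p ->
  exists q : 'I_m -> 'rV[int]_n, (forall i, lattice_points F (q i)) /\
    row_free (homog_mx (@of_int R n \o q)).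
Proof.
move=> [s [v ->]] /choice[w Hw] /aff_indep_row_free p_free.
pose V := homog_mx (@of_int R n \o v).
have pV : homog_mx p = (\matrix_i \row_j w i j) *m V.
  apply/row_matrixP => i; rewrite row_mul !rowK mulmx_homog /homog_row.
  have [_ w1 ->] := Hw i; congr row_mx.
    by rewrite -[1 in LHS]w1; congr (_%:M); apply: eq_bigr => j _; rewrite mxE.
  by apply: eq_bigr => j _; rewrite mxE.
have [|g g_free] := @row_free_submatrix _ _ m _ V.
  by rewrite -(eqP p_free) pV mxrankM_maxr.
exists (v \o g); split=> [i|]; first exact: conv_hull_vertex.
suff -> : homog_mx (@of_int R n \o (v \o g)) = rowsub g V by [].
by apply/matrixP => i j; rewrite !mxE.
Qed.

Lemma gp_additive_eq0 P (f : amb n -> int) : {morph f : y z / y + z} ->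
  (forall x, lattice_points P x -> f (deg1 x) = 0) ->
  forall z, gp P z -> f z = 0.
Proof.
move=> fD f1; have f0 : f 0 = 0 by apply: (addrI (f 0)); rewrite -fD !addr0.
have fS : forall z, semigp P z -> f z = 0.
  by apply: semigp_ind => // y z _ _ fy fz; rewrite fD fy fz addr0.
move=> z [a [b [/fS fa /fS fb ->]]].
by apply: (addIr (f b)); rewrite -fD subrK fa fb.
Qed.

Lemma gpD P y z : gp P y -> gp P z -> gp P (y + z).
Proof.
move=> [a [b [Pa Pb ->]]] [c [d [Pc Pd ->]]].
by exists (a + c), (b + d); split; rewrite ?opprD 1?addrACA //; apply: semigpD.
Qed.

Lemma gpN P z : gp P z -> gp P (- z).
Proof. by move=> [a [b [Pa Pb ->]]]; exists b, a; rewrite opprB. Qed.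

Lemma gp_semigp P z : semigp P z -> gp P z.
Proof. by exists z, 0; rewrite subr0; split=> //; apply: semigp0. Qed.

Lemma gpMz P z (c : int) : gp P z -> gp P (z *~ c).
Proof.
move=> Pz; have PzMn m : gp P (z *+ m).
  by elim: m => [|m IH]; [apply/gp_semigp/semigp0 | rewrite mulrS; apply: gpD].
by case: c => m; rewrite ?NegzE ?mulrNz; [|apply: gpN]; apply: PzMn.
Qed.

End LatticePoints.
(** The height above the facet F, normalized to be onto Z and extended to
    Z^(n+1), is all that is used of the position of F in P.  The last field
    says that S_F generates the kernel up to torsion. *)
Record lattice_height (R : realType) (n : nat) (P F : set 'rV[R]_n)
    (f : amb n -> int) : Prop := LatticeHeight {
  heightD : {morph f : y z / y + z};
  height_ge0 : forall x, lattice_points P x -> 0 <= f (deg1 x);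
  height_eq0 : forall x, lattice_points P x ->
    lattice_points F x <-> f (deg1 x) = 0;
  height_onto : exists w, f w = 1;
  height_torsion : exists2 D, (0 < D)%N & forall z, f z = 0 -> gp F (z *+ D)
}.

(** The least positive value divides all values: a remainder would be a smaller
    one. *)
Lemma normalize_additive (n : nat) (g : amb n -> int) : {morph g : y z / y + z} ->
  (exists w, 0 < g w) -> exists f : amb n -> int, exists2 d : int, 0 < d &
    [/\ {morph f : y z / y + z}, forall z, g z = f z * d & exists w, f w = 1].
Proof.
move=> gD [w0 gw0].
have g0 : g 0 = 0 by apply: (addrI (g 0)); rewrite -gD !addr0.
have gN z : g (- z) = - g z by apply/eqP; rewrite -addr_eq0 -gD addNr g0.
have gMz z (c : int) : g (z *~ c) = g z * c.
  have gMn m : g (z *+ m) = g z * m%:Z.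
    elim: m => [|m IH]; first by rewrite mulr0.
    by rewrite mulrS gD IH intS mulrDr mulr1.
  by case: c => m; rewrite ?NegzE ?mulrNz ?gN ?mulrN; rewrite -gMn.
have ex : exists m : nat, `[< (0 < m)%N /\ exists z, g z = m%:Z >].
  exists `|g w0|%N; apply/asboolP; split; first by rewrite absz_gt0 gt_eqF.
  by exists w0; rewrite gtz0_abs.
case: (ex_minnP ex) => m /asboolP[m0 [z1 gz1]] m_min.
have gE z : g z = (g z %/ m)%Z * m.
  rewrite [LHS](divz_eq (g z) m) -[RHS]addr0; congr (_ + _).
  have m_neq0 : m%:Z != 0 by rewrite eqz_nat -lt0n.
  have := modz_ge0 (g z) m_neq0; rewrite le_eqVlt => /orP[/eqP <-//|r0].
  have := ltz_mod (g z) m_neq0; rewrite ltNge => /negP[].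
  rewrite -(gtz0_abs r0) lez_nat; apply: m_min; apply/asboolP.
  split; first by rewrite absz_gt0 gt_eqF.
  exists (z - z1 *~ (g z %/ m)%Z); rewrite gtz0_abs // gD gN gMz gz1.
  by rewrite {1}(divz_eq (g z) m) [m%:Z * _]mulrC addrAC subrr add0r.
have m_neq0 : m%:Z != 0 by rewrite eqz_nat -lt0n.
exists (fun z => (g z %/ m)%Z), m%:Z => //; split=> // [y z|].
  by apply: (mulIf m_neq0); rewrite mulrDl -!gE gD.
by exists z1; rewrite gz1 divzz m_neq0.
Qed.

Section FacetHeight.
Context (R : realType) (n : nat) (P F H : set 'rV[R]_n).
Hypothesis P_polytope : lattice_polytope P.
Hypothesis P_gp : gp P = setT.
Hypothesis F_polytope : lattice_polytope F.
Hypothesis H_affine : affine_subspace H.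
Hypothesis FE : F = P `&` H.
Hypothesis F_interior : F `&` interior P = set0.

Lemma base_sub : F `<=` P. Proof. by rewrite FE => x []. Qed.

(** The interior of a full simplex in F would lie in the interior of P. *)
Lemma base_no_simplex (p : 'I_(1 + n) -> 'rV[R]_n) :
  (forall i, F (p i)) -> homog_mx p \notin unitmx.
Proof.
move=> Fp; apply/negP => p_unit.
have [x Fx] : exists x, interior F x.
  apply: interior_simplex p_unit => w; case: F_polytope Fp => m [v ->] Fp.
  exact: conv_hull_sum.
suff : (F `&` interior P) x by rewrite F_interior.
by split; [apply: interior_subset Fx | apply: interiorS Fx; apply: base_sub].
Qed.

Lemma affdim_base_le : affdim F <= n%:Z - 1.
Proof.
rewrite -ltzD1 subrK lt_neqAle affdim_le andbT; apply/eqP => E.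
have [|p [Fp /aff_indep_row_free]] := @affdim_exists _ _ F (1 + n).
  by rewrite E add1n -addn1 PoszD addrK.
by rewrite row_free_unit; apply/negP/base_no_simplex.
Qed.

Context (q : 'I_n -> 'rV[int]_n).
Hypothesis Fq : forall i, lattice_points F (q i).
Hypothesis q_free : row_free (homog_mx (@of_int R n \o q)).

Let QZ : 'M[int]_(n, 1 + n) := \matrix_i zrow (deg1 (q i)).
Let QR : 'M[R]_(n, 1 + n) := homog_mx (@of_int R n \o q).
(** Up to sign and a constant factor, fZ is the height; fR is the corresponding
    affine form on R^n. *)
Let fZ (z : amb n) : int := detform QZ (zrow z).
Let fR (x : 'rV[R]_n) : R := detform QR (homog_row x).

Let map_QZ : map_mx intr QZ = QR.
Proof.
by apply/row_matrixP => i; rewrite -map_row !rowK map_zrow_deg1.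
Qed.

Let fR_of_int x : fR (of_int R x) = (fZ (deg1 x))%:~R.
Proof. by rewrite /fR -map_zrow_deg1 -map_QZ detform_map. Qed.

Let fZD : {morph fZ : y z / y + z}.
Proof. by move=> y z; rewrite /fZ raddfD detformD. Qed.

Let homog_row_affine (t : R) (x y : 'rV[R]_n) :
  homog_row ((1 - t) *: x + t *: y) = (1 - t) *: homog_row x + t *: homog_row y.
Proof.
rewrite /homog_row !scale_row_mx add_row_mx !scale_scalar_mx -raddfD !mulr1.
by rewrite subrK.
Qed.

Let fR_affine (t : R) x y :
  fR ((1 - t) *: x + t *: y) = (1 - t) * fR x + t * fR y.
Proof. by rewrite /fR homog_row_affine detformD !detformZ. Qed.

(** Otherwise fZ would vanish on gp(S_P), that is, everywhere. *)
Let fZ_neq0 : exists2 x, lattice_points P x & fZ (deg1 x) != 0.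
Proof.
apply: contrapT => none.
have f0 z : fZ z = 0.
  apply: (@gp_additive_eq0 _ _ P) => //; last by rewrite P_gp.
  by move=> x Px; apply/eqP/contraT => nz; case: none; exists x.
have [i /eqP] := detform_neq0_exists q_free; apply.
pose u : 'rV[int]_(1 + n) := delta_mx 0 i.
pose z : amb n := (rsubmx u, lsubmx u 0 0).
have zE : zrow z = u by rewrite /zrow -mx11_scalar hsubmxK.
have -> : delta_mx 0 i = map_mx intr (zrow z) :> 'rV[R]__.
  rewrite zE; apply/matrixP => a b; rewrite !mxE.
  by case: (_ && _).
by rewrite -/QR -map_QZ detform_map -[detform _ _]/(fZ z) f0.
Qed.

Let fR_simplex x : fR x != 0 -> exists2 p : 'I_(1 + n) -> 'rV[R]_n,
  homog_mx p \in unitmx & forall i, p i = x \/ F (p i).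
Proof.
move=> nz; pose p (i : 'I_(1 + n)) :=
  match fintype.split i with inl _ => x | inr j => of_int R (q j) end.
exists p; last first.
  by move=> i; rewrite /p; case: fintype.split => j; [left | right; apply: Fq].
rewrite unitmxE unitfE; suff -> : homog_mx p = col_mx (homog_row x) QR by [].
apply/row_matrixP => i; rewrite rowK /p; case: (splitP i) => j ij.
  have -> : i = lshift n j by apply: val_inj.
  by rewrite rowKu (ord1 j) [RHS]row_id.
have -> : i = rshift 1 j by apply: val_inj.
by rewrite rowKd rowK.
Qed.

(** A point of F with fR x <> 0 would complete the q i to a full simplex; a
    point of P with fR x = 0 is an affine combination of the q i by Cramer's rule. *)
Let fR_eq0 x : P x -> F x <-> fR x = 0.
Proof.
move=> Px; split=> [Fx | fx0].
  apply/eqP/contraT => /fR_simplex[p p_unit px].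
  have /negP[] // : homog_mx p \notin unitmx.
  by apply: base_no_simplex => i; have [->|] := px i.
have [x0 Px0 nz] := fZ_neq0.
have nzR : fR (of_int R x0) != 0 by rewrite fR_of_int intr_eq0.
have [b] := detform_cramer (homog_row x) nzR.
rewrite -/(fR x) fx0 scale0r add0r.
move=> /(congr1 (fun u => (fR (of_int R x0))^-1 *: u)).
rewrite scalerA mulVf // scale1r scalemxAl mulmx_homog.
move=> /eq_row_mx[/matrixP/(_ 0 0)]; rewrite !mxE eqxx !mulr1n => /esym sum1 xE.
rewrite FE; split=> //; rewrite xE.
apply: affine_subspace_sum => // i.
by have := Fq i; rewrite /lattice_points FE => -[].
Qed.

Let interior_P : exists x, interior P x.
Proof.
have [x0 Px0 nz] := fZ_neq0.
have [|p p_unit px] := @fR_simplex (of_int R x0); first by rewrite fR_of_int intr_eq0.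
apply: interior_simplex p_unit => w; case: P_polytope px Px0 => m [v PE] px Px0.
rewrite PE; apply: conv_hull_sum => i; rewrite -PE.
by have [->|/base_sub] := px i.
Qed.

(** A segment from an interior point to a point on the other side of the
    hyperplane spanned by F would cross F in the interior of P. *)
Let fR_sign : exists2 e : int, e * e = 1 & forall x, P x -> 0 <= e%:~R * fR x.
Proof.
have [c Pc] := interior_P.
have fc0 : fR c != 0.
  apply/eqP => /fR_eq0 Fc; suff : (F `&` interior P) c by rewrite F_interior.
  by split=> //; apply: Fc; apply: interior_subset.
have opposite x : P x -> 0 <= fR c * fR x.
  move=> Px; rewrite leNgt; apply/negP => lt0.
  set a := fR c in fc0 lt0; set b := fR x in lt0.
  have D0 : 0 < a * a - a * b by rewrite subr_gt0 (lt_le_trans lt0) // sqr_ge0.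
  (* The parameter at which the segment meets the hyperplane, with numerator
     and denominator multiplied by a to make both nonnegative. *)
  pose t := a * a / (a * a - a * b).
  have t01 : 0 <= t < 1.
    rewrite /t ltr_pdivrMr // mul1r ltrBrDl gtrDr lt0 andbT.
    by rewrite divr_ge0 ?sqr_ge0 // ltW.
  have fz : fR ((1 - t) *: c + t *: x) = 0.
    apply: (mulfI fc0); rewrite fR_affine -/a -/b mulr0.
    have -> : a * ((1 - t) * a + t * b) = a * a - t * (a * a - a * b).
      by rewrite mulrDr !(mulrCA a) mulrBl mul1r mulrBr opprB addrA addrAC.
    by rewrite /t divfK ?gt_eqF // subrr.
  have inP := interior_segment (lattice_polytope_convex P_polytope) Pc Px t01.
  suff : (F `&` interior P) ((1 - t) *: c + t *: x) by rewrite F_interior.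
  by split=> //; apply/fR_eq0 => //; apply: interior_subset.
case: (ltrgtP (fR c) 0) fc0 => // fc _.
  exists (-1) => // x /opposite; rewrite mulN1r oppr_ge0.
  by rewrite nmulr_rge0.
by exists 1 => // x /opposite; rewrite mul1r pmulr_rge0.
Qed.

Lemma base_is_face : face P F.
Proof.
have [e ee e_ge0] := fR_sign.
have e_neq0 : e%:~R != 0 :> R.
  by rewrite intr_eq0; apply/eqP => e0; move: ee; rewrite e0 mul0r.
pose c := detcoef QR.
have fRE x : fR x =
    usubmx (c : 'cV_(1 + n)) 0 0 + (x *m dsubmx (c : 'cV_(1 + n))) 0 0.
  by rewrite /fR detformE -/c -{1}[c]vsubmxK mul_row_col mul1mx mxE.
exists (- e%:~R *: dsubmx (c : 'cV_(1 + n))).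
exists (e%:~R * usubmx (c : 'cV_(1 + n)) 0 0).
have sideE x : (x *m (- e%:~R *: dsubmx (c : 'cV_(1 + n)))) 0 0 =
    e%:~R * usubmx (c : 'cV_(1 + n)) 0 0 - e%:~R * fR x.
  by rewrite fRE -scalemxAr mxE mulrDr opprD addNKr mulNr.
split=> [x Px|]; first by rewrite sideE gerBl e_ge0.
rewrite eqEsubset; split=> x /=.
  move=> Fx; have Px := base_sub Fx; split=> //.
  by rewrite sideE ((fR_eq0 Px).1 Fx) mulr0 subr0.
case=> Px; rewrite sideE => E; apply/(fR_eq0 Px)/(mulfI e_neq0); rewrite mulr0.
by move/eqP: E; rewrite -subr_eq0 addrAC subrr add0r oppr_eq0 => /eqP.
Qed.

Lemma lattice_height_exists : exists f, lattice_height P F f.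
Proof.
have [e ee e_ge0] := fR_sign.
have e_neq0 : e != 0 by apply/eqP => e0; move: ee; rewrite e0 mul0r.
pose g z := e * fZ z.
have gD : {morph g : y z / y + z} by move=> y z; rewrite /g fZD mulrDr.
have g_ge0 x : lattice_points P x -> 0 <= g (deg1 x).
  by move=> /e_ge0; rewrite fR_of_int -intrM ler0z.
have [x0 Px0 nz] := fZ_neq0.
have [|f [d d0 [fD gE [w fw]]]] := normalize_additive gD.
  by exists (deg1 x0); rewrite lt_neqAle g_ge0 // eq_sym mulf_neq0.
exists f; split=> // [x /g_ge0|x Px||].
- by rewrite gE pmulr_lge0.
- have -> : lattice_points F x <-> fZ (deg1 x) = 0.
    apply: iff_trans (fR_eq0 Px) _; rewrite fR_of_int.
    by split=> [/eqP|->]; rewrite ?intr_eq0 => // /eqP.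
  have d_neq0 : d != 0 by rewrite gt_eqF.
  split=> E; first by apply: (mulIf d_neq0); rewrite -gE /g E mulr0 mul0r.
  by apply: (mulfI e_neq0); rewrite -/(g _) gE E mul0r mulr0.
- by exists w.
exists `|fZ (deg1 x0)|%N; first by rewrite absz_gt0.
move=> z fz0.
have fZz : fZ z = 0 by apply: (mulfI e_neq0); rewrite -/(g _) gE fz0 mul0r mulr0.
suff Fz : gp F (z *~ fZ (deg1 x0)).
  case: (fZ _) Fz => m //; rewrite NegzE mulrNz => /gpN.
  by rewrite opprK.
have [b] := detform_cramer (zrow z) nz.
rewrite -/(fZ z) fZz scale0r add0r => E.
have -> : z *~ fZ (deg1 x0) = \sum_i deg1 (q i) *~ b 0 i.
  apply: zrow_inj; rewrite raddfMz -scaler_int intz [LHS]E mulmx_sum_row.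
  rewrite raddf_sum; apply: eq_bigr => i _.
  by rewrite raddfMz -scaler_int intz rowK.
apply: (big_ind (gp F)) => [||i _]; first exact/gp_semigp/semigp0.
  exact: gpD.
exact/gpMz/gp_semigp/semigp_deg1.
Qed.

End FacetHeight.
(** * Column vectors *)

Section LatticePointsFinite.
Context (R : realType) (n : nat).

(** The coordinates of a convex combination are bounded by those of the
    vertices. *)
Lemma lattice_polytope_finite (P : set 'rV[R]_n) : lattice_polytope P ->
  exists s : seq 'rV[int]_n, forall x, lattice_points P x -> x \in s.
Proof.
move=> [m [p PE]]; pose B := (\sum_i \sum_j `|p i ord0 j|)%N.
pose u (g : {ffun 'I_n -> 'I_(B + B).+1}) : 'rV[int]_n := \row_j ((g j)%:Z - B%:Z).
exists [seq u g | g : {ffun 'I_n -> 'I_(B + B).+1}] => x.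
rewrite /lattice_points PE => -[w [w0 w1 xE]].
have xB j : `|x 0 j| <= B%:Z.
  rewrite -(ler_int R) intr_norm.
  have -> : (x 0 j)%:~R = \sum_i w i * (p i 0 j)%:~R :> R.
    have := congr1 (fun y : 'rV[R]_n => y 0 j) xE; rewrite !mxE summxE => ->.
    by apply: eq_bigr => i _; rewrite !mxE.
  apply: le_trans (ler_norm_sum _ _ _) _.
  have -> : B%:~R = \sum_i w i * B%:~R :> R by rewrite -mulr_suml w1 mul1r.
  apply: ler_sum => i _; rewrite normrM ger0_norm // ler_wpM2l //.
  rewrite -intr_norm ler_int -abszE lez_nat.
  rewrite /B (bigD1 i) //= (bigD1 j) //= -addnA; exact: leq_addr.
have xj j : 0 <= x 0 j + B%:Z < (B + B).+1%:Z.
  by have := xB j; rewrite ler_norml => /andP[? ?]; apply/andP; split; lia.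
pose g : {ffun 'I_n -> 'I_(B + B).+1} := [ffun j => inord (absz (x 0 j + B%:Z))].
apply/mapP; exists g; first by rewrite mem_enum.
apply/rowP => j; rewrite !mxE ffunE; have /andP[ge0 lt] := xj j.
have absE : (absz (x 0 j + B%:Z))%:Z = x 0 j + B%:Z by rewrite gez0_abs.
by rewrite inordK ?absE ?addrK // -ltz_nat absE.
Qed.

End LatticePointsFinite.

Section ColumnVectors.
Context (R : realType) (n : nat) (P F : set 'rV[R]_n) (f : amb n -> int).
Hypothesis P_polytope : lattice_polytope P.
Hypothesis P_gp : gp P = setT.
Hypothesis F_facet : facet P F.
Hypothesis F_sub : F `<=` P.
Hypothesis f_height : lattice_height P F f.

Let fD := heightD f_height.

Lemma height0 : f 0 = 0.
Proof. by apply: (addrI (f 0)); rewrite -fD !addr0. Qed.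

Lemma heightN z : f (- z) = - f z.
Proof. by apply/eqP; rewrite -addr_eq0 -fD addNr height0. Qed.

Lemma heightMn z m : f (z *+ m) = f z *+ m.
Proof. by elim: m => [|m IH]; rewrite ?height0 // !mulrS fD IH. Qed.

Lemma height_semigp_ge0 z : semigp P z -> 0 <= f z.
Proof.
move: z; apply: semigp_ind; first by rewrite height0.
  by move=> y z _ _ fy fz; rewrite fD addr_ge0.
exact: height_ge0 f_height.
Qed.

Lemma height_semigp_eq0 z : semigp P z -> (semigp F z <-> f z = 0).
Proof.
move=> Pz; split.
  move: z {Pz}; apply: semigp_ind; first exact: height0.
    by move=> y z _ _ fy fz; rewrite fD fy fz.
  by move=> x Fx; apply/(height_eq0 f_height) => //; apply: F_sub.
move: z Pz; apply: semigp_ind; first by move=> _; apply: semigp0.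
  move=> y z Py Pz Sy Sz; rewrite fD => /eqP.
  rewrite paddr_eq0 ?height_semigp_ge0 // => /andP[/eqP/Sy Fy /eqP/Sz Fz].
  exact: semigpD.
by move=> x Px /(height_eq0 f_height Px); apply: semigp_deg1.
Qed.

Lemma height_off_facet : exists2 x, lattice_points P x & 0 < f (deg1 x).
Proof.
apply: contrapT => none; have [w fw] := height_onto f_height.
suff : f w = 0 by rewrite fw.
apply: (gp_additive_eq0 (P := P)) => //; last by rewrite P_gp.
move=> x Px; apply/eqP; rewrite eq_le (height_ge0 f_height) // andbT leNgt.
by apply/negP => lt0; apply: none; exists x.
Qed.

Lemma deg1_addMn x v m : deg1 (x + v *+ m) = deg1 x + deg0 v *+ m :> amb n.
Proof.
have -> : deg0 v *+ m = deg0 (v *+ m).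
  by elim: m => // m IH; rewrite !mulrS IH; congr (_, _); rewrite /= addr0.
by congr (_, _); rewrite /= addr0.
Qed.

(** Adding v again and again must end, since P has finitely many lattice
    points, and it can only end on F. *)
Lemma column_reaches_facet v x : column_vector P F v -> lattice_points P x ->
  exists m, lattice_points F (x + v *+ m).
Proof.
move=> [v0 _ Pv] Px; apply: contrapT => none.
have Pxm m : lattice_points P (x + v *+ m).
  elim: m => [|m IH]; first by rewrite addr0.
  rewrite mulrSr addrA; apply: Pv => // Fx; apply: none; by exists m.
have [s Ps] := lattice_polytope_finite P_polytope.
have [j vj] : exists j, v 0 j != 0.
  by have /rV0Pn := v0.
pose t := [seq x + v *+ m | m <- iota 0 (size s).+1].
have t_uniq : uniq t.
  rewrite map_inj_uniq ?iota_uniq // => a b /addrI/(congr1 (fun u : 'rV_n => u 0 j)).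
  by rewrite !mulmxnE => /(mulrIn vj).
have := uniq_leq_size (s2 := s) t_uniq; rewrite size_map size_iota ltnn.
by move=> /(_ _)/negP[] // y /mapP[m _ ->]; apply: Ps.
Qed.

(** By [column_reaches_facet], the opposite of the height of v is positive and
    divides the heights of all lattice points of P, hence all heights, and
    some height is 1. *)
Lemma column_height v : column_vector P F v -> f (deg0 v) = -1.
Proof.
move=> col; have reach x : lattice_points P x ->
    exists m, f (deg1 x) = - f (deg0 v) *+ m.
  move=> Px; have [m Fm] := column_reaches_facet col Px; exists m.
  move/(height_eq0 f_height (F_sub Fm)): Fm; rewrite deg1_addMn fD heightMn.
  by move/eqP; rewrite addr_eq0 mulNrn => /eqP.
set c := - f (deg0 v) in reach; suff : c = 1 by rewrite /c => <-; rewrite opprK.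
have c_dvd z : semigp P z -> (c %| f z)%Z.
  move: z; apply: semigp_ind; first by rewrite height0 dvdz0.
    by move=> y z _ _ ? ?; rewrite fD; apply: rpredD.
  by move=> x /reach[m ->]; rewrite -mulr_natr dvdz_mulr.
have [w fw] := height_onto f_height.
have [a [b [Pa Pb wE]]] : gp P w by rewrite P_gp.
have : (c %| f w)%Z by rewrite wE fD heightN; apply: rpredB; apply: c_dvd.
rewrite fw dvdz1 => /eqP absc.
have [x Px fx] := height_off_facet; have [m fxE] := reach x Px.
have : 0 < c.
  rewrite ltNge; apply/negP => c0; move: fx; rewrite fxE ltNge => /negP[].
  by rewrite mulrn_wle0.
by move=> c0; rewrite -[c]gtz0_abs // absc.
Qed.

Lemma column_lattice_point v x j : column_vector P F v -> lattice_points P x ->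
  j%:Z <= f (deg1 x) -> lattice_points P (x + v *+ j).
Proof.
move=> col Px; have [_ _ Pv] := col.
elim: j => [|j IH] le_j; first by rewrite addr0.
have Pj : lattice_points P (x + v *+ j).
  by apply: IH; apply: le_trans le_j; rewrite lez_nat.
rewrite mulrSr addrA; apply: Pv => //.
move=> /(height_eq0 f_height Pj); rewrite deg1_addMn fD heightMn column_height //.
by move: le_j; rewrite mulNrn natz; lia.
Qed.

Lemma column_semigp v z j : column_vector P F v -> semigp P z ->
  j%:Z <= f z -> semigp P (z + deg0 v *+ j).
Proof.
move=> col Pz; move: z Pz j; apply: semigp_ind.
- by move=> j; rewrite height0 lez_nat leqn0 => /eqP ->; rewrite addr0; apply: semigp0.
- move=> y z Py Pz Sy Sz j; rewrite fD => le_j.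
  have fy := height_semigp_ge0 Py; have fz := height_semigp_ge0 Pz.
  pose i := minn j `|f y|%N.
  have -> : y + z + deg0 v *+ j = (y + deg0 v *+ i) + (z + deg0 v *+ (j - i)).
    by rewrite addrACA -mulrnDr subnKC // geq_minl.
  by apply: semigpD; [apply: Sy | apply: Sz]; rewrite /i; lia.
- move=> x Px j le_j; rewrite -deg1_addMn; apply: semigp_deg1.
  exact: column_lattice_point.
Qed.

(** Adding v to z can go on exactly until height 0. *)
Lemma column_ht v z : column_vector P F v -> semigp P z ->
  ht P F v z = `|f z|%N.
Proof.
move=> col Pz; rewrite /ht; case: asboolP => [Fz|_].
  by rewrite (height_semigp_eq0 Pz).1.
have fz := height_semigp_ge0 Pz.
have max j : semigp P (z + deg0 v *+ j) -> (j <= `|f z|)%N.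
  by move=> /height_semigp_ge0; rewrite fD heightMn column_height //; lia.
have Pmax : semigp P (z + deg0 v *+ `|f z|%N) by apply: column_semigp => //; lia.
apply: xget_subset1; first by split.
move=> a b [Pa maxa] [Pb maxb]; apply/eqP.
by rewrite eqn_leq maxa // maxb.
Qed.

(** Moving x by its full height times v ends in F, and x + v lies on the way. *)
Lemma columnI v : f (deg0 v) = -1 ->
  (forall x, lattice_points P x -> lattice_points F (x + v *+ `|f (deg1 x)|%N)) ->
  column_vector P F v.
Proof.
move=> fv vF; split=> //.
  apply/eqP => v0; move: fv; rewrite v0 (_ : deg0 0 = 0) // height0.
  by [].
move=> x Px Fx; have := vF x Px.
have f_gt0 : 0 < f (deg1 x).
  rewrite lt_neqAle (height_ge0 f_height) // andbT eq_sym.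
  apply/eqP => /(height_eq0 f_height Px).
  exact: Fx.
case: (`|f (deg1 x)|%N) (gtz0_abs f_gt0) => [E|m _ /F_sub Pm].
  by move: f_gt0; rewrite -E.
pose t : R := m.+1%:R^-1.
have -> : of_int R (x + v) = (1 - t) *: of_int R x + t *: of_int R (x + v *+ m.+1).
  apply/rowP => j; rewrite !mxE mulmxnE !rmorphD /= rmorphMn /= mulrDr addrA.
  rewrite -mulrDl subrK mul1r; congr (_ + _).
  by rewrite -mulr_natl mulrA /t mulVf ?mul1r // pnatr_eq0.
apply: lattice_polytope_convex => //.
by rewrite /t invr_ge0 ler0n invf_le1 ?ltr0n // ler1n.
Qed.

Lemma column_enumeration : exists2 s : seq 'rV[int]_n, uniq s &
  forall v, v \in s <-> column_vector P F v.
Proof.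
have [sP Ps] := lattice_polytope_finite P_polytope.
have [x Px fx] := height_off_facet.
exists (undup [seq v <- [seq y - x | y <- sP] | `[< column_vector P F v >]]).
  exact: undup_uniq.
move=> v; rewrite mem_undup mem_filter; split=> [/andP[/asboolP]//|col].
apply/andP; split; first exact/asboolP.
apply/mapP; exists (x + v); last by rewrite addrAC subrr add0r.
by apply: Ps; rewrite -[v]mulr1n; apply: column_lattice_point => //; lia.
Qed.

End ColumnVectors.
(** * Automorphisms given by sums of column vectors *)

Lemma exprDn_mul (A : comNzRingType) (a b u : A) m :
  (a + b) ^+ m * u = \sum_(i < m.+1) (a ^+ (m - i) * (b ^+ i * u)) *+ 'C(m, i).
Proof.
rewrite exprDn mulr_suml; apply: eq_bigr => i _.
by rewrite mulrnAl mulrA.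
Qed.

Lemma exprD1_mul (A : comNzRingType) (b u : A) m :
  (1 + b) ^+ m * u = \sum_(i < m.+1) (b ^+ i * u) *+ 'C(m, i).
Proof. by rewrite exprDn_mul; apply: eq_bigr => i _; rewrite expr1n mul1r. Qed.

Section ColumnAutomorphisms.
Context (k : fieldType) (R : realType) (n : nat).
Context (P F : set 'rV[R]_n) (f : amb n -> int).
Hypothesis P_polytope : lattice_polytope P.
Hypothesis P_gp : gp P = setT.
Hypothesis F_facet : facet P F.
Hypothesis F_sub : F `<=` P.
Hypothesis f_height : lattice_height P F f.

Let fD := heightD f_height.

Definition columns : set (amb n) :=
  [set z | exists2 v, column_vector P F v & z = deg0 v].

Lemma columns_height z : columns z -> f z = -1.
Proof. by case=> v col ->; apply: column_height col. Qed.

Lemma supp_columns_height (tau : grpalg k (amb n)) :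
  supp_in columns tau -> supp_in [set z | f z = -1] tau.
Proof. by move=> H z /H /columns_height. Qed.

(** For tau = lambda v this is the elementary automorphism of v; putting all
    column vectors of the facet into one tau makes composition addition. *)
Definition colmon (tau : grpalg k (amb n)) (z : amb n) : grpalg k (amb n) :=
  (1 + tau) ^+ `|f z|%N * mon k z.

Definition colaut tau : grpalg k (amb n) -> grpalg k (amb n) := lin (colmon tau).

(** Each monomial of (1 + tau)^m is a sum of at most m column vectors, and z of
    height m allows that many steps. *)
Lemma colmon_supp tau z : supp_in columns tau -> semigp P z ->
  supp_in [set y | semigp P y /\ y.2 = z.2] (colmon tau z).
Proof.
(* S i: the vectors of degree 0 that lower the height by at most i and may be
   added to every element of S_P of height at least i. *)
move=> tau_col Pz; pose S (i : nat) : set (amb n) := [set y | [/\ - i%:Z <= f y,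
  y.2 = 0 & forall x, semigp P x -> i%:Z <= f x -> semigp P (x + y)]].
have S0 : S 0%N 0.
  by split=> [||x Px _]; rewrite ?(height0 f_height) ?addr0.
have SS i x y : S 1%N x -> S i y -> S i.+1 (x + y).
  move=> [fx dx Sx] [fy dy Sy]; split.
  - by rewrite fD; lia.
  - by rewrite /= dx dy.
  - move=> u Pu fu; rewrite addrA; apply: Sy; last by rewrite fD; lia.
    by apply: Sx => //; lia.
have S1 : supp_in (S 1%N) (1 + tau).
  apply: supp_inD.
    apply: supp_in_mon.
    by split=> [||x]; rewrite ?(height0 f_height) ?addr0.
  move=> y /tau_col[v col ->]; split=> [||x Px fx].
  - by rewrite (column_height P_polytope P_gp F_sub f_height col).
  - by [].
  - by have := @column_semigp _ _ _ _ _ P_polytope P_gp F_sub f_height v x 1 col Px; apply.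
have := @supp_in_mon k _ [set z] z erefl.
apply: supp_inM (supp_inX (m := `|f z|%N) S0 SS S1) => y x [_ dy Sy] ->.
have fz := height_semigp_ge0 f_height Pz.
by split; [rewrite addrC; apply: Sy => //; lia | rewrite /= dy add0r].
Qed.

Lemma colmonD tau y z : semigp P y -> semigp P z ->
  colmon tau (y + z) = colmon tau y * colmon tau z.
Proof.
move=> /(height_semigp_ge0 f_height) fy /(height_semigp_ge0 f_height) fz.
rewrite /colmon fD monD mulrACA -exprD; congr (_ ^+ _ * _).
by lia.
Qed.

Lemma colmon0 tau : colmon tau 0 = 1.
Proof. by rewrite /colmon (height0 f_height) mul1r. Qed.

Lemma colaut_lrmorphism tau : supp_in columns tau ->
  exists e : {lrmorphism polyalg k P -> polyalg k P},
    forall g, polyalg_val (e g) = colaut tau (polyalg_val g).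
Proof.
move=> tau_col; apply: polyalg_lrmorphism; last exact: colmonD.
  by move=> z Pz y /(colmon_supp tau_col Pz)[].
exact: colmon0.
Qed.

Lemma colaut_homog tau m g : supp_in [set z | f z = m%:Z] g ->
  colaut tau g = (1 + tau) ^+ m * g.
Proof.
move=> g_m; rewrite [g in RHS]grpalgE /colaut /lin mulr_sumr big_seq [RHS]big_seq.
by apply: eq_bigr => z /g_m /= fz; rewrite /colmon fz -scalerAr.
Qed.

Lemma supp_heightX_mon tau j z : supp_in [set z | f z = -1] tau ->
  supp_in [set y | f y = f z - j%:Z] (tau ^+ j * mon k z).
Proof.
move=> tau_h; have := @supp_in_mon k _ [set z] z erefl.
have tau_j : supp_in [set y | f y = - j%:Z] (tau ^+ j).
  apply: (supp_inX (S := fun i => [set y | f y = - i%:Z])) => //.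
    exact: height0 f_height.
  by move=> i x y /= fx fy; rewrite fD fx fy; lia.
by apply: supp_inM tau_j => y x /= fy ->; rewrite fD fy addrC.
Qed.

(** The term tau'^j z of the expansion has height m - j, so the outer map
    multiplies it by (1 + tau)^(m - j); this is the binomial expansion of
    (1 + tau + tau')^m z. *)
Lemma colautK_mon tau tau' z : supp_in columns tau -> supp_in columns tau' ->
  semigp P z -> colaut tau (colmon tau' z) = colmon (tau + tau') z.
Proof.
move=> tau_col /supp_columns_height tau'_h Pz.
have fz := height_semigp_ge0 f_height Pz.
rewrite /colmon addrA [RHS]exprDn_mul (exprD1_mul tau' (mon k z)).
rewrite /colaut linear_sum; apply: eq_bigr => j _.
rewrite [LHS]linearMn; apply: (congr1 (fun u => u *+ 'C(`|f z|, j))).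
apply: colaut_homog => y /(supp_heightX_mon tau'_h) /= ->.
by have := ltn_ord j; lia.
Qed.

Lemma colautD tau tau' g : supp_in columns tau -> supp_in columns tau' ->
  supp_in (semigp P) g -> colaut tau (colaut tau' g) = colaut (tau + tau') g.
Proof.
move=> tau_col tau'_col Pg; rewrite {1}/colaut [LHS]lin_raddf.
by apply: eq_lin Pg _ => z Pz; apply: colautK_mon.
Qed.

Lemma colaut0 g : colaut 0 g = g.
Proof.
rewrite -[RHS]lin_id; apply: (eq_lin (S := setT)) => // z _.
by rewrite /colmon addr0 expr1n mul1r.
Qed.

Definition facet_mon (z : amb n) : grpalg k (amb n) :=
  if f z == 0 then mon k z else 0.

Lemma facet_proj_lrmorphism :
  exists pi : {lrmorphism polyalg k P -> polyalg k F},
    forall g, polyalg_val (pi g) = lin facet_mon (polyalg_val g).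
Proof.
apply: polyalg_lrmorphism.
- move=> z Pz; rewrite /facet_mon; case: eqP => [fz|_]; last exact: supp_in0.
  by apply: supp_in_mon; apply/(height_semigp_eq0 F_sub f_height Pz).
- by rewrite /facet_mon (height0 f_height).
- move=> y z /(height_semigp_ge0 f_height) fy /(height_semigp_ge0 f_height) fz.
  rewrite /facet_mon fD paddr_eq0 // monD.
  by case: (f y == 0); case: (f z == 0); rewrite ?mulr0 ?mul0r.
Qed.

(** In the expansion of (1 + tau)^m z the term tau^j z has height m - j, so only
    the last one survives. *)
Lemma facet_proj_colmon tau z : supp_in columns tau -> semigp P z ->
  lin facet_mon (colmon tau z) = tau ^+ `|f z|%N * mon k z.
Proof.
move=> /supp_columns_height tau_h Pz.
have fz := height_semigp_ge0 f_height Pz.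
have lin_h j : lin facet_mon (tau ^+ j * mon k z) =
    if f z == j%:Z then tau ^+ j * mon k z else 0.
  have supp_j := supp_heightX_mon (j := j) (z := z) tau_h.
  case: eqP => fzj.
    rewrite -[RHS]lin_id; apply: eq_lin supp_j _ => y /= fy.
    by rewrite /facet_mon fy fzj subrr eqxx.
  rewrite /lin big_seq big1 // => y /supp_j /= fy.
  by rewrite /facet_mon fy subr_eq0 (introF eqP fzj) scaler0.
set u := tau ^+ `|f z| * mon k z.
transitivity (\sum_(i < `|f z|.+1) if i == ord_max then u else 0); last first.
  by rewrite -big_mkcond big_pred1_eq.
rewrite /colmon (exprD1_mul tau (mon k z)) linear_sum; apply: eq_bigr => i _.
rewrite [LHS]linearMn.
apply: etrans (congr1 (fun v => v *+ 'C(`|f z|, i)) (lin_h i)) _.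
have [->|i_max] := eqVneq i ord_max.
  by rewrite /= gez0_abs // eqxx binn.
rewrite ifF ?mul0rn //.
apply/negP => /eqP/(congr1 absz) fzi.
by case/eqP: i_max; apply: val_inj; apply: esym.
Qed.

End ColumnAutomorphisms.
(** * Retractions of k[P] onto k[F] *)

Lemma subr_swap (V : zmodType) (x y c d : V) : x - y = c - d -> x + d = y + c.
Proof. by move/eqP; rewrite subr_eq => /eqP ->; rewrite addrAC subrK addrC. Qed.

Section FacetRetractions.
Context (k : fieldType) (R : realType) (n : nat).
Context (P F : set 'rV[R]_n) (f : amb n -> int).
Hypothesis P_polytope : lattice_polytope P.
Hypothesis P_gp : gp P = setT.
Hypothesis F_facet : facet P F.
Hypothesis F_sub : F `<=` P.
Hypothesis f_height : lattice_height P F f.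

Let fD := heightD f_height.
Let f_ge0 := height_semigp_ge0 f_height.
Let f_eq0 := height_semigp_eq0 F_sub f_height.
Let fMn := heightMn f_height.

(** A graded retraction of k[P] onto k[F], recorded on monomials and with values
    in the group algebra, where division by a monomial is possible. *)
Record monomial_retraction (g : amb n -> grpalg k (amb n)) : Prop := {
  retr_supp : forall z, semigp P z ->
    supp_in [set y | semigp F y /\ y.2 = z.2] (g z);
  retrD : forall y z, semigp P y -> semigp P z -> g (y + z) = g y * g z;
  retr_id : forall z, semigp F z -> g z = mon k z
}.

(** The vector s lowers every monomial to the facet in as many steps as its
    height. *)
Lemma column_of_shift s :
  (forall x, lattice_points P x -> semigp F (deg1 x + s *+ `|f (deg1 x)|%N) /\
     (deg1 x + s *+ `|f (deg1 x)|%N).2 = 1) ->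
  columns P F s.
Proof.
move=> sF; have [x Px fx] := height_off_facet P_gp f_height.
have m_gt0 : (0 < `|f (deg1 x)|)%N by rewrite absz_gt0 gt_eqF.
have [Fx degx] := sF x Px.
have f_s : f s = -1.
  have /f_eq0[+ _] : semigp P (deg1 x + s *+ `|f (deg1 x)|%N) by apply: semigpS Fx.
  move=> /(_ Fx); rewrite fD fMn -mulr_natr => E; nia.
have deg_s : s.2 = 0.
  move: degx; rewrite /= => /eqP; rewrite -subr_eq0 addrAC subrr add0r.
  have -> : (s *+ `|f (deg1 x)|).2 = s.2 *+ `|f (deg1 x)|.
    by elim: `|_|%N => // m IH; rewrite !mulrS /= IH.
  by rewrite mulrn_eq0 eqn0Ngt m_gt0 => /eqP.
have sE : s = deg0 s.1 by case: s deg_s {sF Fx degx f_s} => ? ? /= ->.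
exists s.1 => //; apply: (columnI P_polytope F_facet F_sub f_height).
  by rewrite -sE.
move=> y Py; have [Fy _] := sF y Py; apply: semigp_homog1.
by rewrite deg1_addMn -sE.
Qed.

(** The sigma for which z |-> sigma^(f z) z is again a graded retraction onto
    k[F]. *)
Definition admissible (sigma : grpalg k (amb n)) : Prop :=
  forall z, semigp P z ->
    supp_in [set y | semigp F y /\ y.2 = z.2] (sigma ^+ `|f z|%N * mon k z).

(** The leading monomial of sigma^m z is s *+ m + z, which must lie in S_F. *)
Lemma leading_column sigma s : admissible sigma -> leading sigma s ->
  columns P F s.
Proof.
move=> adm lead_s; apply: column_of_shift => x Px.
have := adm _ (semigp_deg1 Px); rewrite addrC; apply.
by have [] := leadingM (leadingX `|f (deg1 x)|%N lead_s) (leading_mon k (deg1 x)).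
Qed.

(** Composing the retraction with the elementary automorphism of a leading
    column vector removes it from sigma. *)
Lemma admissible_peel sigma s (c : k) : admissible sigma -> columns P F s ->
  admissible (sigma - c *: mon k s).
Proof.
move=> adm [v col ->] z Pz; have fz := f_ge0 Pz.
have f_v := column_height P_polytope P_gp F_sub f_height col.
rewrite (exprDn_mul sigma (- (c *: mon k (deg0 v))) (mon k z)).
apply: supp_in_sum => j _; rewrite -scaler_nat; apply: supp_inZ.
have -> : (- (c *: mon k (deg0 v))) ^+ j = (- c) ^+ j *: mon k (deg0 v *+ j).
  by rewrite -scaleNr exprZn monMn.
rewrite -scalerAl -scalerAr -monD [_ + z]addrC; apply: supp_inZ.
have le_j := ltn_ord j.
have Pzj : semigp P (z + deg0 v *+ j).
  by apply: (column_semigp P_polytope P_gp F_sub f_height col Pz); lia.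
have -> : (`|f z| - j)%N = `|f (z + deg0 v *+ j)|%N.
  by rewrite fD fMn f_v mulNrn natz; lia.
have -> : z.2 = (z + deg0 v *+ j).2.
  have vj : (deg0 v *+ j).2 = 0.
    by elim: (j : nat) => // m IH; rewrite mulrS /= IH.
  by rewrite -[RHS]/(z.2 + (deg0 v *+ j).2) vj addr0.
exact: adm.
Qed.

(** Induction on the number of terms of sigma, removing the leading one. *)
Lemma admissible_columns sigma :
  admissible sigma -> supp_in (columns P F) sigma.
Proof.
have [N] := ubnP #|` msupp sigma|; elim: N sigma => // N IH sigma.
rewrite ltnS => le_N adm; have [->|] := eqVneq sigma 0; first exact: supp_in0.
move=> /leading_exists[s lead_s]; have col := leading_column adm lead_s.
pose c := mcoeff s sigma; have [sigma_s _] := lead_s.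
have -> : sigma = (sigma - c *: mon k s) + c *: mon k s by rewrite subrK.
apply: supp_inD; last by apply: supp_inZ; apply: supp_in_mon.
apply: IH; last exact: admissible_peel.
apply: leq_trans le_N.
apply: leq_ltn_trans (fproper_ltn_card (fproperD1 sigma_s)).
apply: fsubset_leq_card; apply/fsubsetP => y.
rewrite in_fsetD1 -!mcoeff_neq0 mcoeffB (mcoeffZ c (mon k s)) mcoeff_mon.
have [->|ys] := eqVneq y s; first by rewrite mulr1 subrr eqxx.
by rewrite mulr0 subr0.
Qed.

Section Retraction.
Context (g : amb n -> grpalg k (amb n)).
Hypothesis g_retr : monomial_retraction g.

Lemma retr0 : g 0 = 1.
Proof. by rewrite (retr_id g_retr) //; apply: semigp0. Qed.

Lemma retrMn z m : semigp P z -> g (z *+ m) = g z ^+ m.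
Proof.
move=> Pz; elim: m => [|m IH]; first exact: retr0.
by rewrite mulrS exprS (retrD g_retr) ?IH //; apply: semigpMn.
Qed.

Lemma semigp_sub z : semigp F z -> semigp P z.
Proof. exact: semigpS. Qed.

Lemma amb_mulrIn m : (0 < m)%N -> injective (fun z : amb n => z *+ m).
Proof.
move=> m0 y z E; apply/eqP; rewrite -subr_eq0; apply/eqP.
have {E} : (y - z) *+ m = 0 by rewrite mulrnBl E subrr.
move: (y - z) => [x a] E.
have E2 : forall l, ((x, a) : amb n) *+ l = (x *+ l, a *+ l).
  by elim=> // l IH; rewrite !mulrS IH.
move: E; rewrite E2 => -[/rowP xm am]; congr (_, _).
  apply/rowP => j; have := xm j; rewrite mulmxnE !mxE => /eqP.
  by rewrite mulrn_eq0 eqn0Ngt m0 => /eqP.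
by move/eqP: am; rewrite mulrn_eq0 eqn0Ngt m0 => /eqP.
Qed.

(** Suitable multiples of z and z0 differ by an element of gp(S_F), so a power
    of g z is, up to monomials, a power of g z0. *)
Lemma retr_vanish z0 : semigp P z0 -> g z0 = 0 ->
  forall z, semigp P z -> 0 < f z -> g z = 0.
Proof.
move=> Pz0 g0 z Pz fz; have [D D0 torsion] := height_torsion f_height.
have fz0 := f_ge0 Pz0.
have [c [c' [Fc Fc' E]]] : gp F ((z *+ `|f z0|%N - z0 *+ `|f z|%N) *+ D).
  apply: torsion; rewrite fD (heightN f_height) !fMn.
  rewrite -(mulr_natr (f z)) -(mulr_natr (f z0)) !natz.
  by rewrite !gez0_abs ?(ltW fz) // mulrC subrr.
have relation : (z *+ (`|f z0| * D)) + c' = z0 *+ (`|f z| * D) + c.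
  by apply: subr_swap; rewrite -E mulrnBl !mulrnA.
have := congr1 g relation.
rewrite (retrD g_retr (semigpMn _ Pz) (semigp_sub Fc')).
rewrite (retrD g_retr (semigpMn _ Pz0) (semigp_sub Fc)).
rewrite (retrMn _ Pz) (retrMn _ Pz0) (retr_id g_retr Fc') g0.
have -> : 0 ^+ (`|f z| * D) = 0 :> grpalg k (amb n).
  by rewrite expr0n muln_eq0 absz_eq0 (gt_eqF fz) (gtn_eqF D0).
rewrite mul0r => /grpalg_mulf_eq0[|c'0]; first exact: grpalg_expf_eq0.
by have := leading_neq0 (leading_mon k c'); rewrite c'0 eqxx.
Qed.

(** When no monomial goes to 0, taking leading monomials is a homomorphism from
    the semigroup of P to that of F.  It fixes F, so it moves every monomial by
    a multiple of one vector; this yields the first column vector. *)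
Lemma leading_shift : (forall z, semigp P z -> g z != 0) ->
  exists s, forall z, semigp P z -> leading (g z) (z + s *+ `|f z|%N).
Proof.
move=> g_neq0.
have /choice[rho Hrho] z : exists a, semigp P z -> leading (g z) a.
  have [Pz|nPz] := pselect (semigp P z); last by exists 0.
  by have [a] := leading_exists (g_neq0 z Pz); exists a.
have rhoD y z : semigp P y -> semigp P z -> rho (y + z) = rho y + rho z.
  move=> Py Pz; apply: leading_uniq (Hrho _ (semigpD Py Pz)) _.
  by rewrite (retrD g_retr) //; apply: leadingM; apply: Hrho.
have rhoF z : semigp F z -> rho z = z.
  move=> Fz; apply: leading_uniq (Hrho _ (semigp_sub Fz)) _.
  by rewrite (retr_id g_retr) //; apply: leading_mon.
have rhoMn z m : semigp P z -> rho (z *+ m) = rho z *+ m.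
  move=> Pz; elim: m => [|m IH]; first by rewrite rhoF //; apply: semigp0.
  by rewrite !mulrS rhoD ?IH //; apply: semigpMn.
have [w fw] := height_onto f_height.
have [a [b [Pa Pb wE]]] : gp P w by rewrite P_gp.
exists (rho a - rho b - w) => z Pz; set m := `|f z|%N.
suff -> : z + (rho a - rho b - w) *+ m = rho z by apply: Hrho.
have [D D0 torsion] := height_torsion f_height.
have fz := f_ge0 Pz.
have [c [c' [Fc Fc' E]]] : gp F ((z - w *+ m) *+ D).
  by apply: torsion; rewrite fD (heightN f_height) fMn fw -mulr_natr /m; lia.
have zwE : z *+ D - w *+ (m * D) = c - c' by rewrite -E mulrnBl mulrnA.
have relation : z *+ D + b *+ (m * D) + c' = a *+ (m * D) + c.
  by apply: subr_swap; rewrite -zwE wE mulrnBl opprB addrA.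
have := congr1 rho relation.
have Pc := semigp_sub Fc; have Pc' := semigp_sub Fc'.
have PzD : semigp P (z *+ D) by apply: semigpMn.
have PaD : semigp P (a *+ (m * D)) by apply: semigpMn.
have PbD : semigp P (b *+ (m * D)) by apply: semigpMn.
rewrite (rhoD _ _ (semigpD PzD PbD) Pc') (rhoD _ _ PzD PbD) (rhoD _ _ PaD Pc).
rewrite (rhoMn _ _ Pz) (rhoMn _ _ Pa) (rhoMn _ _ Pb) (rhoF _ Fc) (rhoF _ Fc').
move=> rho_rel; apply: (amb_mulrIn D0) => /=.
have -> : rho z *+ D = rho a *+ (m * D) + c - c' - rho b *+ (m * D).
  by rewrite -rho_rel !addrK.
rewrite mulrnDl -mulrnA !mulrnBl -[z *+ D](subrK (w *+ (m * D))) zwE.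
by rewrite addrACA subrr addr0 addrA [c - c' + _]addrC addrA.
Qed.

(** With y of height 1 and u = y + s in F, every z satisfies the relation
    z + m u = (z + m s) + m y between elements of S_P, where m is its height;
    applying g expresses g z through g y. *)
Lemma retr_formula : exists2 sigma, supp_in (columns P F) sigma &
  forall z, semigp P z -> g z = sigma ^+ `|f z|%N * mon k z.
Proof.
suff [sigma gE] : exists sigma,
    forall z, semigp P z -> g z = sigma ^+ `|f z|%N * mon k z.
  exists sigma => //; apply: admissible_columns => z Pz.
  by rewrite -gE //; apply: (retr_supp g_retr).
have [[z0 [Pz0 g0]]|g_neq0] := pselect (exists z0, semigp P z0 /\ g z0 = 0).
  exists 0 => z Pz; have := f_ge0 Pz; rewrite le_eqVlt => /orP[/eqP fz|fz].
    rewrite -fz mul1r (retr_id g_retr) //.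
    by apply/f_eq0.
  by rewrite (retr_vanish Pz0 g0) // expr0n absz_eq0 gt_eqF // mul0r.
have [z Pz|s Hs] := leading_shift.
  by apply/eqP => gz; apply: g_neq0; exists z.
have shiftF z : semigp P z -> semigp F (z + s *+ `|f z|%N) /\
    (z + s *+ `|f z|%N).2 = z.2.
  by move=> Pz; have [/(retr_supp g_retr Pz)] := Hs z Pz.
have [v col sE] : columns P F s.
  by apply: column_of_shift => x Px; apply: shiftF; apply: semigp_deg1.
have f_s : f s = -1.
  by rewrite sE; apply: column_height col.
have [x Px fx] := height_off_facet P_gp f_height.
pose y := deg1 x + s *+ `|f (deg1 x)|.-1.
have Py : semigp P y.
  rewrite /y sE; apply: (column_semigp P_polytope P_gp F_sub f_height col).
    exact: semigp_deg1.
  by lia.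
have fy : f y = 1 by rewrite fD fMn f_s mulNrn natz; lia.
have := (shiftF y Py).1; rewrite fy mulr1n; set u := y + s => Fu.
exists (g y * mon k (- y)) => z Pz; set m := `|f z|%N.
have relation : z + u *+ m = (z + s *+ m) + y *+ m.
  by rewrite /u mulrnDl -addrA [y *+ m + _]addrC.
apply: (@mulIr_mon _ _ (u *+ m)) => /=.
rewrite -mulrA -monD relation.
have := congr1 g relation.
have Pzs : semigp P (z + s *+ m) by apply: semigp_sub (shiftF z Pz).1.
have Pu : semigp P u by apply: semigp_sub.
rewrite (retrD g_retr Pz (semigpMn _ Pu)) (retrD g_retr Pzs (semigpMn _ Py)).
rewrite (retrMn _ Pu) (retrMn _ Py) (retr_id g_retr Fu).
rewrite (retr_id g_retr (shiftF z Pz).1) -monMn => ->.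
have yE : (g y * mon k (- y)) ^+ m * mon k (y *+ m) = g y ^+ m.
  by rewrite monMn -exprMn mulr_monN.
by rewrite -yE (monD k (z + s *+ m) (y *+ m)); apply: mulrCA.
Qed.

End Retraction.

End FacetRetractions.
(** * Retractions with a base *)

Section BaseRetraction.
Context (k : fieldType) (R : realType) (n : nat) (P F : set 'rV[R]_n).
Context (h : {lrmorphism polyalg k P -> polyalg k P}).
Hypothesis F_sub : F `<=` P.
Hypothesis h_graded : graded h.
Hypothesis h_bij : set_bij (subpolyalg F) (range h) h.

Lemma base_inj u v : supp_in (semigp F) (polyalg_val u) ->
  supp_in (semigp F) (polyalg_val v) -> h u = h v -> u = v.
Proof.
case: h_bij => _ inj _ Fu Fv; apply: inj; rewrite in_setE; exact/supportedP.
Qed.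

(** Stated for a set T of degrees, to cover both degree d and degrees other than
    d. *)
Lemma graded_supp (T : set int) u : supp_in [set z | T z.2] (polyalg_val u) ->
  supp_in [set z | T z.2] (polyalg_val (h u)).
Proof.
apply: (polyalg_ind (T := [set v | supp_in [set z | T z.2] (polyalg_val (h v))])).
- by rewrite /= raddf0; apply: supp_in0.
- by move=> c v w /= Sv Sw; rewrite linearP; apply: supp_inD Sw; apply: supp_inZ.
move=> z Pz Tz y hy /=; rewrite (h_graded (d := z.2) _ hy) //.
by move=> x; rewrite msupp_mon => /eqP ->.
Qed.

(** The element of k[F] with the same image as z is homogeneous: its component
    in the degree of z already has that image. *)
Lemma base_section_homog u z (Pz : semigp P z) :
  supp_in (semigp F) (polyalg_val u) -> h u = h (pmon k Pz) ->
  supp_in [set y | y.2 = z.2] (polyalg_val u).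
Proof.
move=> Fu huE.
pose phi (y : amb n) : grpalg k (amb n) := if y.2 == z.2 then mon k y else 0.
pose u1 := lin phi (polyalg_val u).
have u1_deg : supp_in [set y | y.2 = z.2] u1.
  apply: (supp_in_lin (S := setT)) => // y _; rewrite /phi.
  by case: eqP => [yz|_]; [apply: supp_in_mon | apply: supp_in0].
have u1_F : supp_in (semigp F) u1.
  apply: supp_in_lin Fu _ => y Fy; rewrite /phi.
  by case: ifP => _; [apply: supp_in_mon | apply: supp_in0].
have u2_deg : supp_in [set y | y.2 <> z.2] (polyalg_val u - u1).
  rewrite -{1}[polyalg_val u]lin_id /u1 /lin -sumrB; apply: supp_in_sum => y _.
  rewrite -scalerBr; apply: supp_inZ; rewrite /phi; case: eqP => yz.
    by rewrite subrr; apply: supp_in0.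
  by rewrite subr0; apply: supp_in_mon.
have u1_P : u1 \in supported P.
  by apply/supportedP => y /u1_F; apply: semigpS.
pose v : polyalg k P := PolyAlg u1_P.
have hv1 : supp_in [set y | y.2 = z.2] (polyalg_val (h v)).
  exact: (graded_supp (T := [set d | d = z.2])).
have hz : supp_in [set y | y.2 = z.2] (polyalg_val (h (pmon k Pz))).
  apply: (graded_supp (T := [set d | d = z.2])) => y /=.
  by rewrite msupp_mon => /eqP ->.
have hv2 : supp_in [set y | y.2 <> z.2] (polyalg_val (h (u - v))).
  exact: (graded_supp (T := [set d | d <> z.2])).
have uv0 : h (u - v) = 0.
  apply: val_inj; apply/malgP => y /=; rewrite mcoeff0; apply: mcoeff_outdom.
  apply/negP => hy; apply: (hv2 y hy).
  have : supp_in [set y | y.2 = z.2] (polyalg_val (h (u - v))).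
    rewrite (raddfB h u v) /= huE; apply: supp_inD => //; exact: supp_inN.
  exact.
have -> : u = v by apply: base_inj => //; apply/subr0_eq; rewrite -raddfB.
exact: u1_deg.
Qed.

(** Since h is bijective from k[F] onto its image, h z is the image of a unique
    element of k[F]; uniqueness makes this element multiplicative in z. *)
Lemma base_monomial_retraction : exists2 g : amb n -> grpalg k (amb n),
  monomial_retraction P F g & forall z (Pz : semigp P z) (u : polyalg k P),
    polyalg_val u = g z -> h u = h (pmon k Pz).
Proof.
have /choice[g Hg] z : exists g : grpalg k (amb n), forall Pz : semigp P z,
    exists u : polyalg k P, [/\ polyalg_val u = g, supp_in (semigp F) g &
      h u = h (pmon k Pz)].
  have [Pz|nPz] := pselect (semigp P z); last by exists 0 => Pz; case: (nPz Pz).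
  case: h_bij => _ _ /(_ (h (pmon k Pz)))[|u /= /supportedP Fu hu].
    by exists (pmon k Pz).
  exists (polyalg_val u) => Pz'; exists u; split=> //; rewrite hu.
  by congr (h _); apply: val_inj.
exists g; last first.
  move=> z Pz u uE; have [v [vE _ <-]] := Hg z Pz.
  by congr (h _); apply: val_inj; apply: etrans uE (esym vE).
split.
- move=> z Pz y gy; have [u [uE Fu hu]] := Hg z Pz.
  split; first exact: Fu.
  by apply: (base_section_homog _ hu); rewrite uE.
- move=> y z Py Pz; have [u [<- Fu hu]] := Hg y Py.
  have [v [<- Fv hv]] := Hg z Pz; have [w [<- Fw hw]] := Hg _ (semigpD Py Pz).
  suff -> : w = u * v by [].
  apply: base_inj => //; first by apply: supp_inM Fu Fv; apply: semigpD.
  rewrite (rmorphM h u v) /= hu hv hw -[RHS](rmorphM h).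
  congr (h _); apply: val_inj.
  exact: monD.
- move=> z Fz; have Pz := semigpS F_sub Fz; have [u [<- Fu hu]] := Hg z Pz.
  suff -> : u = pmon k Pz by [].
  by apply: base_inj => // y; rewrite msupp_mon => /eqP ->.
Qed.

End BaseRetraction.
(** * The group A(F) *)

Section ColumnGroup.
Context (k : fieldType) (R : realType) (n : nat).
Context (P F : set 'rV[R]_n) (f : amb n -> int).
Hypothesis P_polytope : lattice_polytope P.
Hypothesis P_gp : gp P = setT.
Hypothesis F_facet : facet P F.
Hypothesis F_sub : F `<=` P.
Hypothesis f_height : lattice_height P F f.

Lemma deg0_inj : injective (@deg0 n).
Proof. by move=> u v []. Qed.

Lemma columns_sum s (v : 'I_s -> 'rV[int]_n) (sigma : grpalg k (amb n)) :
  injective v -> range v = column_vector P F -> supp_in (columns P F) sigma ->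
  \sum_i mcoeff (deg0 (v i)) sigma *: mon k (deg0 (v i)) = sigma.
Proof.
move=> v_inj v_range sigma_col; apply/malgP => z; rewrite raddf_sum /=.
transitivity (\sum_i mcoeff (deg0 (v i)) sigma * (deg0 (v i) == z)%:R).
  apply: eq_bigr => i _.
  by rewrite (mcoeffZ _ (mon k (deg0 (v i)))) mcoeff_mon.
have [[i vi]|nz] := pselect (exists i, deg0 (v i) = z).
  rewrite (bigD1 i) //= vi eqxx mulr1 big1 ?addr0 // => j ji.
  by rewrite -vi (inj_eq deg0_inj) (inj_eq v_inj) (negPf ji) mulr0.
rewrite big1 => [|i _]; last first.
  by case: eqP => [E|_]; rewrite ?mulr0 //; case: nz; exists i.
apply/esym/mcoeff_outdom/negP => /sigma_col[w].
by rewrite -v_range => -[i _ <-] zE; apply: nz; exists i.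
Qed.

(** Split sigma into its terms, one for each column vector, and compose. *)
Lemma colaut_colgroup sigma : supp_in (columns P F) sigma ->
  exists2 eps : polyalg k P -> polyalg k P, colgroup F eps &
    forall g, polyalg_val (eps g) = colaut f sigma (polyalg_val g).
Proof.
move=> sigma_col.
have [s s_uniq sP] := column_enumeration P_polytope P_gp F_sub f_height.
pose v (i : 'I_(size s)) := nth 0 s i.
have v_inj : injective v.
  by move=> i j /eqP; rewrite nth_uniq // => /eqP/val_inj.
have v_col i : column_vector P F (v i) by apply/sP/mem_nth.
have v_range : range v = column_vector P F.
  rewrite eqEsubset; split=> [_ [i _ <-] //|w /sP sw].
  have iw : (index w s < size s)%N by rewrite index_mem.
  by exists (Ordinal iw) => //; rewrite /v /= nth_index.
pose lambda i := mcoeff (deg0 (v i)) sigma.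
pose tau i := lambda i *: mon k (deg0 (v i)).
have tau_col i : supp_in (columns P F) (tau i).
  by apply: supp_inZ; apply: supp_in_mon; exists (v i).
have /choice[e eE] i : exists e : {lrmorphism polyalg k P -> polyalg k P},
    forall g, polyalg_val (e g) = colaut f (tau i) (polyalg_val g).
  exact: (colaut_lrmorphism P_polytope P_gp F_sub f_height (tau_col i)).
exists (\big[comp/id]_(i < size s) (e i : polyalg k P -> polyalg k P)).
  exists (size s), v, lambda, e; split=> // i z Pz.
  rewrite eE /= /colaut lin_mon /colmon /=.
  by rewrite (column_ht P_polytope P_gp F_sub f_height (v_col i) Pz).
rewrite -[sigma in colaut _ sigma](columns_sum v_inj v_range sigma_col).
rewrite -/(tau _) => g.
have sum_col (r : seq 'I_(size s)) : supp_in (columns P F) (\sum_(i <- r) tau i).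
  by apply: supp_in_sum => i _; apply: tau_col.
elim: (index_enum _) => [|i r IH] /=; first by rewrite !big_nil colaut0.
rewrite !big_cons /= eE IH.
apply: (colautD P_polytope P_gp F_sub f_height) => //.
exact: polyalg_supp.
Qed.

End ColumnGroup.

Theorem theorem7p3 (k : closedFieldType) (R : realType) (n : nat)
    (P : set 'rV[R]_n) (F : set 'rV[R]_n)
    (h : {lrmorphism polyalg k P -> polyalg k P})
    (P_polytope : lattice_polytope P)
    (P_dim : affdim P = n%:Z)
    (P_gp : gp P = [set: amb n])
    (h_retraction : retraction h)
    (h_codim : codim h 1)
    (h_base : base h F)
    (F_interior : F `&` interior P = set0) :
  facet P F /\
  exists2 eps : polyalg k P -> polyalg k P, colgroup F eps &
    exists (pi : {lrmorphism polyalg k P -> polyalg k F})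
           (iota : {lrmorphism polyalg k F -> polyalg k P}),
      [/\ face_proj pi, graded iota, injective iota
        & conjugate eps h (iota \o pi)].
Proof.
have [_ h_graded] := h_retraction.
have [d [h_dim F_dim [H H_affine FE] F_polytope h_bij]] := h_base.
have F_sub : F `<=` P := base_sub FE.
have F_dim' : affdim F = n%:Z - 1.
  (* n + 1 <= dim k[P] = dim Im(h) + 1, and dim F = dim Im(h) - 1. *)
  have [a [b [[_ a_max] [b_chain b_max] abE]]] := h_codim.
  have [d_chain d_max] := h_dim.
  have le_a := a_max _ (prime_chain_polyalg k P_gp).
  have le_b := b_max _ d_chain; have le_d := d_max _ b_chain.
  have := affdim_base_le F_polytope FE F_interior.
  by rewrite F_dim; lia.
have [p [Fp p_free]] := affdim_exists F_dim'.
have [q [Fq q_free]] := lattice_polytope_basis F_polytope Fp p_free.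
have F_facet : facet P F.
  split; last by rewrite F_dim' P_dim.
  exact (base_is_face P_polytope P_gp F_polytope H_affine FE F_interior Fq q_free).
split=> //.
have [f f_height] := lattice_height_exists P_polytope P_gp F_polytope H_affine
  FE F_interior Fq q_free.
have [g g_retr gE] := base_monomial_retraction F_sub h_graded h_bij.
have [sigma sigma_col sigmaE] :=
  retr_formula P_polytope P_gp F_facet F_sub f_height g_retr.
have [eps eps_col epsE] := colaut_colgroup P_polytope P_gp F_sub f_height sigma_col.
exists eps => //.
have [pi piE] := facet_proj_lrmorphism k F_sub f_height.
have [incl inclE] : exists i : {lrmorphism polyalg k F -> polyalg k P},
    forall u, polyalg_val (i u) = polyalg_val u.
  have [|||i iE] := @polyalg_lrmorphism k R n F P (@mon k _).
  - by move=> z Fz; apply: supp_in_mon; apply: semigpS Fz.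
  - by [].
  - by move=> y z _ _; apply: monD.
  by exists i => u; rewrite iE lin_id.
have [e eE] := colaut_lrmorphism P_polytope P_gp F_sub f_height sigma_col.
have Nsigma_col : supp_in (columns P F) (- sigma) by apply: supp_inN.
have [e' e'E] := colaut_lrmorphism P_polytope P_gp F_sub f_height Nsigma_col.
have colautK tau tau' (u : polyalg k P) : supp_in (columns P F) tau ->
    supp_in (columns P F) tau' -> tau + tau' = 0 ->
    colaut f tau (colaut f tau' (polyalg_val u)) = polyalg_val u.
  move=> tau_col tau'_col E.
  have Pu : supp_in (semigp P) (polyalg_val u) by apply: polyalg_supp.
  by rewrite (colautD P_polytope P_gp F_sub f_height tau_col tau'_col Pu) E colaut0.
have eK : cancel e e'.
  by move=> u; apply: val_inj; rewrite /= e'E eE colautK // addNr.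
have e'K : cancel e' e.
  by move=> u; apply: val_inj; rewrite /= eE e'E colautK // addrN.
have eps_e u : eps u = e u by apply: val_inj; rewrite /= epsE eE.
(* pi o e computes the element of k[F] with the same image under h. *)
have section : h \o incl \o pi \o e =1 h.
  apply: eq_polyalg_linear => z Pz /=; apply: gE.
  have e_mon : polyalg_val (e (pmon k Pz)) = colmon f sigma z.
    by rewrite eE; apply: lin_mon.
  rewrite inclE piE e_mon (sigmaE z Pz).
  exact: (facet_proj_colmon P_polytope P_gp F_sub f_height sigma_col Pz).
exists pi, (e \o h \o incl); split.
- move=> x Px; split=> [Fx|Fx]; apply: val_inj; rewrite /= piE /= lin_mon.
    by rewrite /facet_mon ((height_eq0 f_height Px).1 Fx) eqxx.
  by rewrite /facet_mon ifF //; apply/eqP => /(height_eq0 f_height Px).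
- move=> m u u_m; apply: (_ : homog m (e (h (incl u)))).
  have : homog m (h (incl u)) by apply: h_graded => z; rewrite inclE; apply: u_m.
  move: (h (incl u)) => w w_m; rewrite /homog eE.
  have Sw : supp_in [set z | semigp P z /\ z.2 = m] (polyalg_val w).
    by move=> z wz; split; [apply: polyalg_supp wz | apply: w_m].
  apply: (supp_in_lin (T := [set z | z.2 = m]) Sw) => z [Pz <-] y.
  by move=> /(colmon_supp P_polytope P_gp F_sub f_height sigma_col Pz)[].
- move=> u v /= /(can_inj eK) huv; apply: val_inj => /=.
  rewrite -!inclE; congr polyalg_val; apply: (base_inj h_bij) huv.
    by rewrite inclE; apply: polyalg_supp.
  by rewrite inclE; apply: polyalg_supp.
- exists e'; split=> [u|u|u].
  + by rewrite eps_e eK.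
  + by rewrite eps_e e'K.
  + by rewrite /= eps_e -[in RHS](section (e' u)) /= e'K.
Qed.
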